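(* Let $u^{N,\varepsilon,\delta}_{\kappa,m}$ be the unique solution of the penalised problem (P$_m$) described in the context. For every $p>1$ there is a constant $c_0=c_0(p,N,\kappa,\varepsilon)>0$ (not depending on $m$ or $\delta$) such that for all $m\in\mathbb N$ $$\big|u^{N,\varepsilon,\delta}_{\kappa,m}(t_1,x_1)-u^{N,\varepsilon,\delta}_{\kappa,m}(t_2,x_2)\big|\le c_0\Big(|t_2-t_1|^{\frac\gamma2\wedge\frac{p-1}{8p}}+|x_2-x_1|^{\frac{p-1}{4p}}\Big)$$ for any $(t_1,x_1),(t_2,x_2)\in\mathcal O_m$ with $|t_2-t_1|\vee|x_2-x_1|\le1$.
   Context: **Setting.** $T\in(0,\infty)$, $\mathcal O=[0,T)\times(0,\infty)$, $\overline{\mathcal O}=[0,T]\times[0,\infty)$; $r\ge0$, $\bar\alpha>0$ constants; $g,h:\overline{\mathcal O}\to[0,\infty)$ continuous; $(\mathcal L\varphi)(t,x)=\frac{\sigma^2(x)}2\partial_{xx}\varphi+\mu(x)\partial_x\varphi$. $C^{j,k;\gamma}_{loc}(\overline{\mathcal O})$: functions that are $\gamma$-Hölder (parabolic distance), with time derivatives up to order $j$ and space derivatives up to order $k$, on every compact subset of $\overline{\mathcal O}$; $C^{j,k;\gamma}_b(\overline{\mathcal O})$: same on all of $\overline{\mathcal O}$, with the function and derivatives bounded; $C^{1,2;\gamma}(\overline{\mathcal O}_m)$ analogous on $\overline{\mathcal O}_m$. **Assumption (SDE).** $\mu:\mathbb R\to\mathbb R$, $\sigma:\mathbb R\to[0,\infty)$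 continuous, $\sigma(x)=\sigma(0)$, $\mu(x)=\mu(0)$ for $x<0$; (i) $\mu\in C^1((0,\infty))$, Lipschitz on $[0,\infty)$ with constant $D_1$; (ii) $\sigma\in C^1((0,\infty))$ and $|\sigma(x)-\sigma(y)|\le D_\gamma|x-y|^{\gamma_\sigma}$ on $[0,\infty)$ for some $\gamma_\sigma>1/2$; (iii) $\sigma>0$ on $(0,\infty)$ and $|\mu(x)|+\sigma(x)\le D_1(1+|x|)$ on $[0,\infty)$. **Assumption (G).** (i) $g\in C^{1,2;\gamma}_{loc}(\overline{\mathcal O})$, $h\in C^{0,1;\gamma}_{loc}(\overline{\mathcal O})$ for some $\gamma\in(0,1)$ (this is the $\gamma$ of the claim), and $g(t,x)-g(s,x)\le K_0(t-s)$, $h(t,x)-h(s,x)\le K_0(t-s)$ for $0\le s\le t\le T$, $x\ge0$; (ii) $|\partial_xg|\le\bar\alpha$; (iii) $0\le h\le K_1(1+|x|^2)$, $0\le g\le K_1(1+|x|)$. With $\Theta:=h+\partial_tg+\mathcal Lg-rg$: (iv) $\Theta$ is locally Lipschitz on $\mathcal O$ and $\Theta\ge-K_2$; (v) $\liminf_{x\to\infty}\Theta(T,x)>0$, $\Theta(T,0)<0$. **Approximating data.** For $N\in\mathbb N$: $g^N\in C^{1,2;\gamma}_b(\overline{\mathcal O})$, $h^N\in C^{0,1;\gamma}_b(\overline{\mathcal O})$, $0\le g^N\le g$, $0\le h^N\le h$, $g^N+h^N\le N$; $g^N=g$ on $\{g\le N-1\}\cap\{0\le x\le N-1\}$, $h^N=h$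 on $\{h\le N-1\}\cap\{0\le x\le N-1\}$; $|h^N(t,x)-h^N(s,y)|\le L_N(|x-y|+|t-s|)$, $|g^N(t,x)-g^N(s,y)|\le\bar\alpha^N(|x-y|+|t-s|)$, where $\bar\alpha^N\downarrow\bar\alpha$ as $N\to\infty$. For $\kappa\in(0,1)$: $\mu_\kappa,\sigma_\kappa\in C([0,\infty))\cap C^1((0,\infty))$, $|\mu_\kappa|\le\kappa^{-1}$, $\kappa\le\sigma_\kappa\le\kappa^{-1}$, $|\mu_\kappa(x)|+\sigma_\kappa(x)\le D_1(1+|x|)$, $(\mu_\kappa,\sigma_\kappa)\to(\mu,\sigma)$ uniformly on compacts of $[0,\infty)$ as $\kappa\to0$; $\mu_\kappa$ is $D_1$-Lipschitz and $\sigma_\kappa$ is $\gamma_\sigma$-Hölder with constant $D_\gamma$ on $[0,\infty)$. $\mathcal L_\kappa$ is $\mathcal L$ with $(\mu_\kappa,\sigma_\kappa)$ in place of $(\mu,\sigma)$. $\Theta^N_\kappa:=h^N+\partial_tg^N+\mathcal L_\kappa g^N-rg^N$ and $\overline\Theta^N_\kappa:=\inf\{x\ge0:\Theta^N_\kappa(T,x)=0\}$. **Localisation.** For $m\in\mathbb N$: $\zeta_m\in C^\infty([0,T])$ (depending also on $\kappa$) is non-decreasing, $\zeta_m=0$ on $[0,T-\frac1m]$, $\zeta_m(T)=\overline\Theta^N_\kappa$; $\xi_m\in C^\infty([0,\infty))$, $0\le\xi_m\le1$, $\xi_m=1$ on $[0,m]$, $\xi_m=0$ on $[m+1,\infty)$,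 $|\dot\xi_m|^2\le C_0\xi_m$, $|\ddot\xi_m|\le C_0$ with $C_0$ independent of $m$. $g^N_m:=\xi_{m-1}g^N$, $h^N_m:=\xi_{m-1}h^N$, $\Theta^N_{\kappa,m}:=h^N_m+\partial_tg^N_m+\mathcal L_\kappa g^N_m-rg^N_m$, and $$(\bar\alpha^N_m(t,x))^2=(\bar\alpha^N)^2+N^2|\dot\xi_m(x)|^2+2g^N(t,x)\xi_m(x)\dot\xi_m(x)\partial_xg^N(t,x),$$ a function which is Lipschitz in $x$ and $\gamma/2$-Hölder in $t$, uniformly in $m$. $N$, $1/\kappa$ and $m$ are assumed sufficiently large, so that in particular $0<\overline\Theta^N_\kappa=\overline\Theta^N_{\kappa,m}<m$, where $\overline\Theta^N_{\kappa,m}:=\inf\{x\ge 0:\Theta^N_{\kappa,m}(T,x)=0\}$. $\mathcal O_m=\{(t,x)\in\mathcal O:\zeta_m(t)<x<m\}$, with parabolic boundary $\partial_P\mathcal O_m=\{(t,\zeta_m(t)):t\in[0,T)\}\cup([0,T)\times\{m\})\cup(\{T\}\times[\overline\Theta^N_\kappa,m])$. **Penalised problem (P$_m$).** For $\varepsilon,\delta\in(0,1)$, $\psi_\varepsilon\in C^2(\mathbb R)$ is non-negative, convex, $\psi_\varepsilon=0$ on $(-\infty,0]$, $\psi_\varepsilon>0$ on $(0,\infty)$, $\psi_\varepsilon'\ge0$, $\psi_\varepsilon(y)=\frac{y-\varepsilon}\varepsilon$ for $y\ge2\varepsilon$. $u=u^{N,\varepsilon,\delta}_{\kappa,m}\in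 C^{1,2;\gamma}(\overline{\mathcal O}_m)$ is the unique solution of $$\partial_tu+\mathcal L_\kappa u-ru=-h^N_m-\tfrac1\delta(g^N_m-u)^++\psi_\varepsilon\big(|\partial_xu|^2-(\bar\alpha^N_m)^2\big)\ \text{on }\mathcal O_m,\qquad u=g^N_m\ \text{on }\partial_P\mathcal O_m.$$ *)

(* Defs.v *)
(* MathComp-Analysis, over an arbitrary R : realType. *)
From HB Require Import structures.
From mathcomp Require Export all_boot all_order all_algebra.
From mathcomp Require Export all_classical all_reals all_analysis.

Set Implicit Arguments.
Unset Strict Implicit.
Unset Printing Implicit Defensive.

Export Order.TTheory GRing.Theory Num.Theory.
Export numFieldNormedType.Exports.

Local Open Scope classical_set_scope.
Local Open Scope ring_scope.

(* Derivatives relative to a set: only the values of f on D are used, so that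
   they are one-sided at the end points of an interval D. *)
Definition derivable_in (R : realType) (D : set R) (f : R -> R) (x : R) : Prop :=
  cvg ((f y - f x) / (y - x) @[y --> within (D `\ x) (nbhs x)]).

Definition deriv_in (R : realType) (D : set R) (f : R -> R) (x : R) : R :=
  lim ((f y - f x) / (y - x) @[y --> within (D `\ x) (nbhs x)]).

Definition smooth_on (R : realType) (D : set R) (f : R -> R) : Prop :=
  forall n x, D x -> derivable_in D (iter n (deriv_in D) f) x.

Definition C1_pos (R : realType) (f : R -> R) : Prop :=
  (forall x : R, 0 < x -> derivable f x 1) /\
  (forall x : R, 0 < x -> {for x, continuous (derive1 f)}).

(* Functions of (t, x) are curried; space-time domains are sets of pairs
   z = (t, x). *)
Definition dt (R : realType) (D : set (R * R)) (f : R -> R -> R) : R -> R -> R :=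
  fun t x => deriv_in [set s | D (s, x)] (fun s => f s x) t.

Definition dx (R : realType) (D : set (R * R)) (f : R -> R -> R) : R -> R -> R :=
  fun t x => deriv_in [set y | D (t, y)] (f t) x.

Definition dxx (R : realType) (D : set (R * R)) (f : R -> R -> R) : R -> R -> R :=
  dx D (dx D f).

Definition pdist (R : realType) (z w : R * R) : R :=
  Num.sqrt (`|z.2 - w.2| ^+ 2 + `|z.1 - w.1|).

Definition pholder (R : realType) (gamma : R) (K : set (R * R))
    (f : R -> R -> R) : Prop :=
  exists C : R, forall z w, K z -> K w ->
    `|f z.1 z.2 - f w.1 w.2| <= C * pdist z w `^ gamma.

Definition bounded_in (R : realType) (K : set (R * R)) (f : R -> R -> R) : Prop :=
  exists C : R, forall z, K z -> `|f z.1 z.2| <= C.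

Definition has_derivatives (R : realType) (D : set (R * R)) (j k : nat)
    (f : R -> R -> R) : Prop :=
  (forall i t x, (i < j)%N -> D (t, x) ->
     derivable_in [set s | D (s, x)] (fun s => iter i (dt D) f s x) t) /\
  (forall i t x, (i < k)%N -> D (t, x) ->
     derivable_in [set y | D (t, y)] (iter i (dx D) f t) x).

Definition all_derivatives (R : realType) (D : set (R * R)) (j k : nat)
    (P : (R -> R -> R) -> Prop) (f : R -> R -> R) : Prop :=
  (forall i, (i <= j)%N -> P (iter i (dt D) f)) /\
  (forall i, (i <= k)%N -> P (iter i (dx D) f)).

(* C^{j,k;gamma}_loc(D) *)
Definition Cloc (R : realType) (j k : nat) (gamma : R) (D : set (R * R))
    (f : R -> R -> R) : Prop :=
  has_derivatives D j k f /\
  forall K : set (R * R), compact K -> K `<=` D ->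
    all_derivatives D j k (pholder gamma K) f.

(* C^{j,k;gamma}_b(D); for compact D this is C^{j,k;gamma}(D), as Hoelder
   continuity on D then implies boundedness. *)
Definition Cb (R : realType) (j k : nat) (gamma : R) (D : set (R * R))
    (f : R -> R -> R) : Prop :=
  [/\ has_derivatives D j k f,
      all_derivatives D j k (pholder gamma D) f &
      all_derivatives D j k (bounded_in D) f].

Definition Odom (R : realType) (T : R) : set (R * R) :=
  [set z | 0 <= z.1 < T /\ 0 < z.2].

Definition Obar (R : realType) (T : R) : set (R * R) :=
  [set z | 0 <= z.1 <= T /\ 0 <= z.2].

Definition gen (R : realType) (D : set (R * R)) (mu sigma : R -> R)
    (f : R -> R -> R) : R -> R -> R :=
  fun t x => sigma x ^+ 2 / 2 * dxx D f t x + mu x * dx D f t x.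

Definition Theta (R : realType) (T r : R) (mu sigma : R -> R)
    (g h : R -> R -> R) : R -> R -> R :=
  fun t x => h t x + dt (Obar T) g t x + gen (Obar T) mu sigma g t x - r * g t x.

(* The infimum is 0 when Th(T, .) has no zero. *)
Definition first_zero (R : realType) (T : R) (Th : R -> R -> R) : R :=
  inf [set x | 0 <= x /\ Th T x = 0].

Record sde_assumption (R : realType) (mu sigma : R -> R)
    (D1 Dgamma gammas : R) : Prop := {
  sde_mu_cont : continuous mu ;
  sde_sigma_cont : continuous sigma ;
  sde_sigma_ge0 : forall x : R, 0 <= sigma x ;
  sde_neg : forall x : R, x < 0 -> sigma x = sigma 0 /\ mu x = mu 0 ;
  sde_mu_C1 : C1_pos mu ;
  sde_mu_lip : forall x y : R, 0 <= x -> 0 <= y ->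
    `|mu x - mu y| <= D1 * `|x - y| ;
  sde_sigma_C1 : C1_pos sigma ;
  sde_gammas : 1 / 2 < gammas ;
  sde_sigma_holder : forall x y : R, 0 <= x -> 0 <= y ->
    `|sigma x - sigma y| <= Dgamma * `|x - y| `^ gammas ;
  sde_sigma_gt0 : forall x : R, 0 < x -> 0 < sigma x ;
  sde_growth : forall x : R, 0 <= x -> `|mu x| + sigma x <= D1 * (1 + `|x|)
}.

Record payoff_assumption (R : realType) (T r alphabar gamma K0 K1 K2 : R)
    (mu sigma : R -> R) (g h : R -> R -> R) : Prop := {
  pay_g_cont : {within Obar T, continuous (fun z : R * R => g z.1 z.2)} ;
  pay_h_cont : {within Obar T, continuous (fun z : R * R => h z.1 z.2)} ;
  pay_g_reg : Cloc 1 2 gamma (Obar T) g ;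
  pay_h_reg : Cloc 0 1 gamma (Obar T) h ;
  pay_g_time : forall s t x : R, 0 <= s -> s <= t -> t <= T -> 0 <= x ->
    g t x - g s x <= K0 * (t - s) ;
  pay_h_time : forall s t x : R, 0 <= s -> s <= t -> t <= T -> 0 <= x ->
    h t x - h s x <= K0 * (t - s) ;
  pay_g_grad : forall t x : R, Obar T (t, x) -> `|dx (Obar T) g t x| <= alphabar ;
  pay_h_growth : forall t x : R, Obar T (t, x) ->
    0 <= h t x <= K1 * (1 + `|x| ^+ 2) ;
  pay_g_growth : forall t x : R, Obar T (t, x) -> 0 <= g t x <= K1 * (1 + `|x|) ;
  pay_Theta_lip : forall z, Odom T z -> exists2 U : set (R * R), nbhs z U &
    [lipschitz (Theta T r mu sigma g h w.1 w.2 : R) | w in U `&` Odom T] ;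
  pay_Theta_lb : forall t x : R, Odom T (t, x) -> - K2 <= Theta T r mu sigma g h t x ;
  pay_Theta_liminf :
    (0 < limf_einf (fun x : R => (Theta T r mu sigma g h T x)%:E) (pinfty_nbhs R))%E ;
  pay_Theta_0 : Theta T r mu sigma g h T 0 < 0
}.

Record approx_payoff (R : realType) (T alphabar gamma : R) (g h : R -> R -> R)
    (gN hN : nat -> R -> R -> R) (alphaN LN : nat -> R) : Prop := {
  app_g_reg : forall N, (0 < N)%N -> Cb 1 2 gamma (Obar T) (gN N) ;
  app_h_reg : forall N, (0 < N)%N -> Cb 0 1 gamma (Obar T) (hN N) ;
  app_g_bounds : forall N t x, (0 < N)%N -> Obar T (t, x) ->
    0 <= gN N t x <= g t x ;
  app_h_bounds : forall N t x, (0 < N)%N -> Obar T (t, x) ->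
    0 <= hN N t x <= h t x ;
  app_sum : forall N t x, (0 < N)%N -> Obar T (t, x) ->
    gN N t x + hN N t x <= N%:R ;
  app_g_eq : forall N t x, (0 < N)%N -> Obar T (t, x) ->
    g t x <= N%:R - 1 -> x <= N%:R - 1 -> gN N t x = g t x ;
  app_h_eq : forall N t x, (0 < N)%N -> Obar T (t, x) ->
    h t x <= N%:R - 1 -> x <= N%:R - 1 -> hN N t x = h t x ;
  app_h_lip : forall N t x s y, (0 < N)%N -> Obar T (t, x) -> Obar T (s, y) ->
    `|hN N t x - hN N s y| <= LN N * (`|x - y| + `|t - s|) ;
  app_g_lip : forall N t x s y, (0 < N)%N -> Obar T (t, x) -> Obar T (s, y) ->
    `|gN N t x - gN N s y| <= alphaN N * (`|x - y| + `|t - s|) ;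
  app_alpha_decr : forall N M, (0 < N)%N -> (N <= M)%N -> alphaN M <= alphaN N ;
  app_alpha_cvg : alphaN @ \oo --> alphabar
}.

Record approx_coef (R : realType) (D1 Dgamma gammas : R) (mu sigma : R -> R)
    (muk sigmak : R -> R -> R) : Prop := {
  coef_mu_cont : forall k : R, 0 < k < 1 -> {within `[0, +oo[, continuous (muk k)} ;
  coef_sigma_cont : forall k : R, 0 < k < 1 ->
    {within `[0, +oo[, continuous (sigmak k)} ;
  coef_mu_C1 : forall k : R, 0 < k < 1 -> C1_pos (muk k) ;
  coef_sigma_C1 : forall k : R, 0 < k < 1 -> C1_pos (sigmak k) ;
  coef_mu_bound : forall k x : R, 0 < k < 1 -> 0 <= x -> `|muk k x| <= k^-1 ;
  coef_sigma_bound : forall k x : R, 0 < k < 1 -> 0 <= x -> k <= sigmak k x <= k^-1 ;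
  coef_growth : forall k x : R, 0 < k < 1 -> 0 <= x ->
    `|muk k x| + sigmak k x <= D1 * (1 + `|x|) ;
  coef_mu_cvg : forall K : set R, compact K -> K `<=` `[0, +oo[ ->
    {uniform K, muk @ 0^'+ --> mu} ;
  coef_sigma_cvg : forall K : set R, compact K -> K `<=` `[0, +oo[ ->
    {uniform K, sigmak @ 0^'+ --> sigma} ;
  coef_mu_lip : forall k x y : R, 0 < k < 1 -> 0 <= x -> 0 <= y ->
    `|muk k x - muk k y| <= D1 * `|x - y| ;
  coef_sigma_holder : forall k x y : R, 0 < k < 1 -> 0 <= x -> 0 <= y ->
    `|sigmak k x - sigmak k y| <= Dgamma * `|x - y| `^ gammas
}.

Record time_cutoff (R : realType) (T theta : R) (zeta : nat -> R -> R) : Prop := {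
  zeta_smooth : forall m, (0 < m)%N -> smooth_on `[0, T] (zeta m) ;
  zeta_nondecr : forall m s t, (0 < m)%N -> 0 <= s -> s <= t -> t <= T ->
    zeta m s <= zeta m t ;
  zeta_0 : forall m t, (0 < m)%N -> 0 <= t -> t <= T - m%:R^-1 -> zeta m t = 0 ;
  zeta_T : forall m, (0 < m)%N -> zeta m T = theta
}.

(* Indexed from m = 0, since xi (m - 1) is used for every m >= 1. *)
Record space_cutoff (R : realType) (C0 : R) (xi : nat -> R -> R) : Prop := {
  xi_smooth : forall m, smooth_on `[0, +oo[ (xi m) ;
  xi_bounds : forall m x, 0 <= x -> 0 <= xi m x <= 1 ;
  xi_1 : forall m x, 0 <= x -> x <= m%:R -> xi m x = 1 ;
  xi_0 : forall m x, m%:R + 1 <= x -> xi m x = 0 ;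
  xi_d1 : forall m x, 0 <= x ->
    `|deriv_in `[0, +oo[ (xi m) x| ^+ 2 <= C0 * xi m x ;
  xi_d2 : forall m x, 0 <= x ->
    `|deriv_in `[0, +oo[ (deriv_in `[0, +oo[ (xi m)) x| <= C0
}.

(* f^N_m = xi_{m-1} f^N *)
Definition localise (R : realType) (xi : nat -> R -> R) (m : nat)
    (f : R -> R -> R) : R -> R -> R := fun t x => xi m.-1 x * f t x.

(* The square (alphabar^N_m)^2; alphaN and gN stand for alphabar^N and g^N. *)
Definition alpha_sq (R : realType) (T : R) (N : nat) (alphaN : R)
    (gN : R -> R -> R) (xi : nat -> R -> R) (m : nat) : R -> R -> R :=
  fun t x => let dxi := deriv_in `[0, +oo[ (xi m) x in
    alphaN ^+ 2 + N%:R ^+ 2 * `|dxi| ^+ 2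
    + 2 * gN t x * xi m x * dxi * dx (Obar T) gN t x.

Definition Om (R : realType) (T : R) (zeta : R -> R) (m : nat) : set (R * R) :=
  [set z | Odom T z /\ zeta z.1 < z.2 < m%:R].

Definition Om_bar (R : realType) (T : R) (zeta : R -> R) (m : nat) : set (R * R) :=
  [set z | 0 <= z.1 <= T /\ zeta z.1 <= z.2 <= m%:R].

Definition parabolic_boundary (R : realType) (T theta : R) (zeta : R -> R)
    (m : nat) : set (R * R) :=
  [set z | 0 <= z.1 < T /\ z.2 = zeta z.1] `|`
  [set z | 0 <= z.1 < T /\ z.2 = m%:R] `|`
  [set z | z.1 = T /\ theta <= z.2 <= m%:R].

Record penalty (R : realType) (eps : R) (psi : R -> R) : Prop := {
  psi_d1 : forall y : R, derivable psi y 1 ;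
  psi_d2 : forall y : R, derivable (derive1 psi) y 1 ;
  psi_C2 : continuous (derive1 (derive1 psi)) ;
  psi_ge0 : forall y : R, 0 <= psi y ;
  psi_convex : convex_function [set: R^o] psi ;
  psi_npos : forall y : R, y <= 0 -> psi y = 0 ;
  psi_pos : forall y : R, 0 < y -> 0 < psi y ;
  psi_nondecr : forall y : R, 0 <= (derive1 psi) y ;
  psi_linear : forall y : R, 2 * eps <= y -> psi y = (y - eps) / eps
}.

(* In the application mu, sigma are mu_kappa, sigma_kappa; g, h are g^N_m, h^N_m;
   asq is (alphabar^N_m)^2. *)
Record penalised_solution (R : realType) (T r gamma theta delta : R)
    (mu sigma : R -> R) (g h asq : R -> R -> R) (zeta : R -> R) (m : nat)
    (psi : R -> R) (u : R -> R -> R) : Prop := {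
  sol_reg : Cb 1 2 gamma (Om_bar T zeta m) u ;
  sol_pde : forall t x : R, Om T zeta m (t, x) ->
    dt (Om_bar T zeta m) u t x + gen (Om_bar T zeta m) mu sigma u t x - r * u t x
    = - h t x - delta^-1 * Num.max (g t x - u t x) 0
      + psi (`|dx (Om_bar T zeta m) u t x| ^+ 2 - asq t x) ;
  sol_boundary : forall t x : R, parabolic_boundary T theta zeta m (t, x) ->
    u t x = g t x
}.

(* Main.v *)
Require Import Defs.
From mathcomp Require Import ring lra.

Set Implicit Arguments.
Unset Strict Implicit.
Unset Printing Implicit Defensive.

Local Open Scope classical_set_scope.
Local Open Scope ring_scope.

(* On Om one has x < m, so xi_m = 1 and the gradient threshold is the constant
   alphaN ^+ 2; the maximum principle then gives a stronger conclusion, a Lipschitz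
   bound in x and a 1/2-Hoelder bound in t. Constant test functions bound u, and
   also the obstacle penalty, because at a maximum of g - u the gradient of u is
   that of g. What remains is u_t + a u_xx + b u_x = F + H(u_x) with F bounded and
   H of quadratic growth. Logarithmic barriers in the distance to the lateral
   boundary absorb the quadratic growth; since zeta is nondecreasing, this distance
   decreases in time, which is the favourable sign, and no bound on zeta' (which
   would depend on m) enters. Doubling the space variable carries the Lipschitz
   bound to the interior, and comparison with paraboloids turns it into a bound in
   time. *)

(** * One-sided derivatives and the second-derivative test *)

(** Two parameters threaten the constant: [m], through a boundary curve that climbs from 0 to
    [theta] within time [1 / m], and [delta], through the factor [1 / delta]. Uniformity is recorded
    by the order of quantifiers: each estimate produces its constant from ellipticity and bounds
    alone, before the boundary curve, [m], [delta] and the solution are introduced. The equation is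
    backward, with data at [T], so a maximum is compared with later times only. Right derivatives in
    time suffice for this, and [t = 0] counts as an interior time. In one space dimension the
    doubled maximum gives each of the two second derivatives a sign of its own, so the leading
    coefficients at the two points are never compared with each other. The resulting exponents 1/2
    and 1 exceed those of the claim, and distances are at most 1, so lowering the exponents only
    enlarges the right-hand side. *)

Definition has_deriv_in (R : realType) (D : set R) (f : R -> R) (x l : R) : Prop :=
  forall e, 0 < e -> exists2 d, 0 < d &
    forall y, D y -> `|y - x| < d -> `|f y - f x - l * (y - x)| <= e * `|y - x|.

(** The division-free form holds trivially at [y = x] and passes to smaller sets; this is how one
    relative derivative later yields both two-sided space derivatives and right time derivatives. *)
Lemma derivable_in_has_deriv (R : realType) (D : set R) (f : R -> R) (x : R) :
  derivable_in D f x -> has_deriv_in D f x (deriv_in D f x).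
Proof.
rewrite /derivable_in => cf e e0.
have cf' : (f y - f x) / (y - x) @[y --> within (D `\ x) (nbhs x)] --> deriv_in D f x.
  by [].
move/cvgrPdist_lt : cf' => /(_ _ e0); rewrite near_withinE.
move=> /nbhs_ballP[d /= d0 H]; exists d => // y Dy yd.
have [->|yx] := eqVneq y x; first by rewrite !subrr mulr0 subrr normr0 mulr0.
have yx0 : y - x != 0 by rewrite subr_eq0.
have /= := H y _ _.
rewrite /ball/= distrC => /(_ yd) /(_ _) /= h.
have {}h : `|deriv_in D f x - (f y - f x) / (y - x)| < e.
  by apply: h; split => //; apply/eqP.
have -> : f y - f x - deriv_in D f x * (y - x)
   = - ((deriv_in D f x - (f y - f x) / (y - x)) * (y - x)).
  by field.
by rewrite normrN normrM ler_wpM2r// ltW.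
Qed.

Lemma has_deriv_in_is_derive (R : realType) (D : set R) (f : R -> R) (x l d : R) :
  0 < d -> (forall y, `|y - x| < d -> D y) ->
  has_deriv_in D f x l -> is_derive x (1 : R) f l.
Proof.
move=> d0 Dd Hf.
suff H : (fun h : R => h^-1 *: ((f \o shift x) (h *: 1) - f x)) @ 0^' --> l.
  by split; [apply/cvg_ex; exists l | apply: cvg_lim].
apply/cvgrPdist_le => e e0.
have [d' d'0 H] := Hf _ e0.
near=> h.
have h0 : h != 0 by near: h; exact: nbhs_dnbhs_neq.
have hd : `|h| < Num.min d d'.
  near: h; apply: dnbhs0_lt; by rewrite lt_min d0.
move: hd; rewrite lt_min => /andP[hd hd'].
rewrite /= /shift/= /GRing.scale/= mulr1.
have := H (h + x) _ _; rewrite addrK => /(_ (Dd _ _) hd').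
rewrite addrK => /(_ hd) h1.
have -> : l - h^-1 * (f (h + x) - f x) = - (h^-1 * (f (h + x) - f x - l * h)).
  by field.
by rewrite normrN normrM normfV ler_pdivrMl ?normr_gt0// [leRHS]mulrC.
Unshelve. all: by end_near.
Qed.

Definition right_deriv (R : realType) (f : R -> R) (t l : R) : Prop :=
  has_deriv_in [set s | t <= s] f t l.

Lemma has_deriv_in_right (R : realType) (D : set R) (f : R -> R) (t l d : R) :
  0 < d -> (forall s, t <= s < t + d -> D s) ->
  has_deriv_in D f t l -> right_deriv f t l.
Proof.
move=> d0 Dd Hf e e0; have [d' d'0 H] := Hf _ e0.
exists (Num.min d d'); first by rewrite lt_min d0.
move=> s /= ts; rewrite lt_min => /andP[h1 h2]; apply: H => //; apply: Dd.
by move: h1; rewrite ger0_norm ?subr_ge0// ts/= => h1; lra.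
Qed.

Lemma right_deriv_le (R : realType) (f : R -> R) (t l k d : R) :
  right_deriv f t l -> 0 < d ->
  (forall s, t < s < t + d -> f s - f t <= k * (s - t)) -> l <= k.
Proof.
move=> Hf d0 H; rewrite leNgt; apply/negP => kl.
have e0 : 0 < (l - k) / 2 by lra.
have [d' d'0 H'] := Hf _ e0.
pose s := t + Num.min d d' / 2.
have m0 : 0 < Num.min d d' by rewrite lt_min d0.
have md : Num.min d d' <= d by rewrite ge_min lexx.
have md' : Num.min d d' <= d' by rewrite ge_min lexx orbT.
have st : 0 < s - t by rewrite /s; lra.
have h1 : f s - f t <= k * (s - t) by apply: H; rewrite /s; lra.
have h2 : `|f s - f t - l * (s - t)| <= (l - k) / 2 * (s - t).
  by rewrite -{2}(gtr0_norm st); apply: H' => /=; rewrite ?(gtr0_norm st) /s; lra.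
have /ler_normlP[h3 h4] := h2.
nra.
Qed.

Lemma right_derivB (R : realType) (f g : R -> R) (t a b : R) :
  right_deriv f t a -> right_deriv g t b ->
  right_deriv (fun s => f s - g s) t (a - b).
Proof.
move=> Hf Hg e e0; have e20 : 0 < e / 2 by lra.
have [d1 d10 H1] := Hf _ e20; have [d2 d20 H2] := Hg _ e20.
exists (Num.min d1 d2); first by rewrite lt_min d10.
move=> s /= ts; rewrite lt_min => /andP[h1 h2].
have {}H1 := H1 _ ts h1; have {}H2 := H2 _ ts h2.
have -> : f s - g s - (f t - g t) - (a - b) * (s - t) =
  (f s - f t - a * (s - t)) - (g s - g t - b * (s - t)) by ring.
apply: le_trans (ler_normB _ _) _; lra.
Qed.

Lemma right_derivZ (R : realType) (c : R) (f : R -> R) (t a : R) :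
  right_deriv f t a -> right_deriv (fun s => c * f s) t (c * a).
Proof.
move=> Hf e e0; have c0 : 0 < `|c| + 1 by have := normr_ge0 c; lra.
have [d d0 H] := Hf _ (divr_gt0 e0 c0).
exists d => // s /= ts h; have {}H := H _ ts h.
have -> : c * f s - c * f t - c * a * (s - t) = c * (f s - f t - a * (s - t)).
  by ring.
rewrite normrM; apply: (@le_trans _ _ ((`|c| + 1) * (e / (`|c| + 1) * `|s - t|))).
  by apply: ler_pM => //; lra.
by rewrite mulrA [_ * (e / _)]mulrC divfK// gt_eqF.
Qed.

(** [f1] is differentiable at [x] only, so the sign of [f2] comes from the mean value theorem for
    [f] to the right of [x] and not from a Taylor expansion. *)
Lemma local_max_deriv2 (R : realType) (f f1 : R -> R) (x d f2 : R) :
  0 < d ->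
  (forall y, `|y - x| < d -> is_derive y (1 : R) f (f1 y)) ->
  is_derive x (1 : R) f1 f2 ->
  (forall y, `|y - x| < d -> f y <= f x) ->
  f1 x = 0 /\ f2 <= 0.
Proof.
move=> d0 Hf1 Hf2 Hmax.
have f10 : f1 x = 0.
  have xin : x \in `]x - d, x + d[ by rewrite in_itv/=; lra.
  have ball_ y : y \in `]x - d, x + d[ -> `|y - x| < d.
    by rewrite in_itv/= ltr_norml; lra.
  have /@derive_val <- : is_derive x (1 : R) f 0.
    apply: (@derive1_at_max _ _ (x - d) (x + d)) => //; first lra.
    - by move=> t /ball_ /Hf1 [].
    - by move=> t /ball_ /Hmax.
  by have [|_ ->] := Hf1 x; rewrite ?subrr ?normr0.
split => //; rewrite leNgt; apply/negP => f20.
(* if f2 > 0 then f' > 0 just to the right of x *)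
have [df1 vf1] := Hf2.
have : (fun h : R => h^-1 *: ((f1 \o shift x) (h *: 1) - f1 x)) @ 0^' --> f2.
  by rewrite -vf1; exact: df1.
have f220 : 0 < f2 / 2 by lra.
move/cvgrPdist_lt => /(_ _ f220).
rewrite near_withinE => /nbhs_ballP[e /= e0 He].
pose r := Num.min d e / 2.
have m0 : 0 < Num.min d e by rewrite lt_min d0.
have md : Num.min d e <= d by rewrite ge_min lexx.
have me : Num.min d e <= e by rewrite ge_min lexx orbT.
have r0 : 0 < r by rewrite /r; lra.
have [|||c] := @MVT _ f f1 x (x + r); first by lra.
- by move=> y; rewrite in_itv/= => hy; apply: Hf1; rewrite ltr_norml /r in hy *; lra.
- apply: derivable_within_continuous => y; rewrite in_itv/= => hy.
  by have [] : is_derive y (1 : R) f (f1 y) by apply: Hf1; rewrite ltr_norml /r in hy *; lra.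
rewrite in_itv/= => hc E.
have h := Hmax (x + r) _.
have {}h : f (x + r) <= f x by apply: h; rewrite ltr_norml /r; lra.
have : f1 c <= 0.
  rewrite leNgt; apply/negP => fc.
  have : 0 < f1 c * (x + r - x) by apply: mulr_gt0 => //; lra.
  lra.
have := He (c - x); rewrite /ball/= sub0r normrN /GRing.scale/= mulr1 f10 subr0 subrK.
have cx : 0 < c - x by lra.
move=> /(_ _ _); rewrite gtr0_norm// => H.
have {}H : `|f2 - (c - x)^-1 * f1 c| < f2 / 2.
  by apply: H; [rewrite /r in hc; lra | rewrite gt_eqF].
move: H; rewrite ltr_norml => /andP[_ H] fc.
have : (c - x)^-1 * f1 c <= 0 by rewrite mulr_ge0_le0// invr_ge0 ltW.
lra.
Qed.

(** * Comparison principle on the moving domain *)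

(** Names the derivatives that the maximum principle reads off, so that it applies to differences,
    multiples and products without unfolding relative derivatives. *)
Record jets (R : realType) (D : set (R * R)) (f ft fx fxx : R -> R -> R) : Prop := {
  jets_t : forall t x, D (t, x) -> right_deriv (f^~ x) t (ft t x) ;
  jets_x : forall t x, D (t, x) -> is_derive x (1 : R) (f t) (fx t x) ;
  jets_xx : forall t x, D (t, x) -> is_derive x (1 : R) (fx t) (fxx t x)
}.

Lemma jetsB (R : realType) (D : set (R * R)) (f ft fx fxx g gt gx gxx : R -> R -> R) :
  jets D f ft fx fxx -> jets D g gt gx gxx ->
  jets D (fun t x => f t x - g t x) (fun t x => ft t x - gt t x)
    (fun t x => fx t x - gx t x) (fun t x => fxx t x - gxx t x).
Proof.
move=> [f1 f2 f3] [g1 g2 g3]; split => t x Dtx.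
- exact: right_derivB (f1 _ _ Dtx) (g1 _ _ Dtx).
- exact: is_deriveB (f2 _ _ Dtx) (g2 _ _ Dtx).
- exact: is_deriveB (f3 _ _ Dtx) (g3 _ _ Dtx).
Qed.

Lemma jetsZ (R : realType) (D : set (R * R)) (c : R) (f ft fx fxx : R -> R -> R) :
  jets D f ft fx fxx ->
  jets D (fun t x => c * f t x) (fun t x => c * ft t x)
    (fun t x => c * fx t x) (fun t x => c * fxx t x).
Proof.
move=> [f1 f2 f3]; split => t x Dtx.
- exact: right_derivZ (f1 _ _ Dtx).
- exact: is_deriveZ (f2 _ _ Dtx).
- exact: is_deriveZ (f3 _ _ Dtx).
Qed.

Lemma jets_sub (R : realType) (D E : set (R * R)) (f ft fx fxx : R -> R -> R) :
  E `<=` D -> jets D f ft fx fxx -> jets E f ft fx fxx.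
Proof. by move=> ED [f1 f2 f3]; split => t x /ED; [exact: f1|exact: f2|exact: f3]. Qed.

Lemma Om_Om_bar (R : realType) (T : R) (z : R -> R) (m : nat) :
  Om T z m `<=` Om_bar T z m.
Proof. by move=> [t x] [[/= /andP[t0 tT] _] /andP[zx xm]]; split => /=; lra. Qed.

Lemma Om_space_nbhs (R : realType) (T : R) (z : R -> R) (m : nat) (t x : R) :
  Om T z m (t, x) ->
  exists2 d, 0 < d & forall y, `|y - x| < d -> Om T z m (t, y).
Proof.
move=> [[/= tT x0] /andP[zx xm]].
exists (Num.min x (Num.min (x - z t) (m%:R - x))).
  by rewrite !lt_min x0 !subr_gt0 zx xm.
move=> y; rewrite !lt_min !ltr_norml => /and3P[h1 h2 h3].
split => /=; first by split => //=; lra.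
by apply/andP; lra.
Qed.

Lemma Om_time_nbhs (R : realType) (T : R) (z : R -> R) (m : nat) (t x : R) :
  continuous z -> Om T z m (t, x) ->
  exists2 d, 0 < d & forall s, t <= s < t + d -> Om T z m (s, x).
Proof.
move=> cz [[/= tT x0] /andP[zx xm]].
have /cvgr_lt/(_ _ zx)/nbhs_ballP[d /= d0 H] := cz t.
exists (Num.min d (T - t)); first by rewrite lt_min d0/=; lra.
move=> s /andP[ts]; rewrite -ltrBlDl lt_min => /andP[sd sT].
split => /=; first by split => //=; lra.
apply/andP; split => //; apply: H.
by rewrite /ball/= distrC ger0_norm ?subr_ge0.
Qed.

Lemma Om_bar_closed (R : realType) (T : R) (z : R -> R) (m : nat) :
  continuous z -> closed (Om_bar T z m).
Proof.
move=> cz.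
have -> : Om_bar T z m = (fun w : R * R => w.1) @^-1` `[0, T] `&`
    (fun w : R * R => w.2 - z w.1) @^-1` `[0, +oo[ `&`
    (fun w : R * R => w.2) @^-1` `]-oo, m%:R].
  apply/seteqP; split => [[t x]|[t x]] /=; rewrite !in_itv/= andbT subr_ge0.
    by move=> [/= h /andP[]].
  by move=> [[h1 h2] h3]; split => //=; rewrite h2.
have c2 : continuous (fun w : R * R => w.2 - z w.1).
  move=> w; apply: cvgB; first exact: cvg_snd.
  by apply: (cvg_comp _ _ (@cvg_fst _ _ _ _ _)); exact: cz.
apply: closedI; first apply: closedI.
- apply: preimage_closed; last exact: interval_closed.
  by move=> w _; exact: cvg_fst.
- apply: preimage_closed; last exact: interval_closed.
  by move=> w _; exact: c2.
- apply: preimage_closed; last exact: interval_closed.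
  by move=> w _; exact: cvg_snd.
Qed.

Lemma Om_bar_compact (R : realType) (T : R) (z : R -> R) (m : nat) :
  continuous z -> (forall t, 0 <= z t) -> compact (Om_bar T z m).
Proof.
move=> cz z0.
have cK : compact (`[0, T]%classic `*` `[0, m%:R]%classic : set (R * R)).
  by apply: compact_setX; exact: segment_compact.
apply: (subclosed_compact _ cK); first exact: Om_bar_closed.
move=> [t x] /= [t0 /andP[zx xm]]; rewrite !in_itv/=; split => //.
by rewrite xm (le_trans (z0 t) zx).
Qed.

(* phi need not be differentiable in time: only its monotonicity enters, so
   that barriers may depend on x - z t. *)
Lemma comparison (R : realType) (T c : R) (z : R -> R) (m : nat)
    (w wt wx wxx phi phix phixx : R -> R -> R) :
  continuous z -> (forall t, 0 <= z t) ->
  {within Om_bar T z m, continuous (fun q : R * R => w q.1 q.2)} ->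
  {within Om_bar T z m, continuous (fun q : R * R => phi q.1 q.2)} ->
  jets (Om T z m) w wt wx wxx ->
  (forall t x, Om T z m (t, x) -> is_derive x (1 : R) (phi t) (phix t x)) ->
  (forall t x, Om T z m (t, x) -> is_derive x (1 : R) (phix t) (phixx t x)) ->
  (forall s t x, Om T z m (s, x) -> Om T z m (t, x) -> s <= t ->
     phi t x <= phi s x - c * (t - s)) ->
  (forall t x, Om_bar T z m (t, x) -> t = T \/ x = z t \/ x = m%:R ->
     w t x <= phi t x) ->
  (forall t x, Om T z m (t, x) -> phi t x < w t x ->
     wt t x <= - c -> wx t x = phix t x -> wxx t x <= phixx t x -> False) ->
  forall t x, Om_bar T z m (t, x) -> w t x <= phi t x.
Proof.
move=> cz z0 cw cphi [jt jx jxx] px pxx pt bd H t x tx.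
have cB : {within Om_bar T z m, continuous (fun q : R * R => w q.1 q.2 - phi q.1 q.2)}.
  by move=> q; apply: cvgB; [exact: cw|exact: cphi].
have ne : Om_bar T z m !=set0 by exists (t, x).
have [[t1 x1] t1x1 max1] := compact_EVT_max ne (@Om_bar_compact _ _ _ _ cz z0) cB.
have {}t1x1 : Om_bar T z m (t1, x1) by rewrite inE in t1x1.
have {}max1 s y : Om_bar T z m (s, y) -> w s y - phi s y <= w t1 x1 - phi t1 x1.
  by move=> sy; apply: (max1 (s, y)); rewrite inE.
have [le1|lt1] := leP (w t1 x1) (phi t1 x1).
  by have := max1 _ _ tx; lra.
exfalso.
have nb : ~ (t1 = T \/ x1 = z t1 \/ x1 = m%:R).
  by move=> b; have := bd _ _ t1x1 b; lra.
have O1 : Om T z m (t1, x1).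
  move: t1x1 => [/= /andP[t10 t1T] /andP[zx xm]].
  have t1T' : t1 < T by rewrite lt_neqAle t1T andbT; apply/eqP => e; apply: nb; left.
  have zx' : z t1 < x1.
    by rewrite lt_neqAle zx andbT; apply/eqP => e; apply: nb; right; left.
  have xm' : x1 < m%:R.
    by rewrite lt_neqAle xm andbT; apply/eqP => e; apply: nb; right; right.
  split => /=; last by rewrite zx' xm'.
  by split; [rewrite t10|apply: le_lt_trans zx'].
have [d d0 Hd] := Om_space_nbhs O1.
have [] := @local_max_deriv2 _ (fun y => w t1 y - phi t1 y)
   (fun y => wx t1 y - phix t1 y) x1 d (wxx t1 x1 - phixx t1 x1) d0.
- move=> y /Hd Oy.
  exact: is_deriveB (jx _ _ Oy) (px _ _ Oy).
- exact: is_deriveB (jxx _ _ O1) (pxx _ _ O1).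
- by move=> y /Hd/Om_Om_bar/max1.
move=> /eqP; rewrite subr_eq0 => /eqP ex; rewrite subr_le0 => exx.
apply: (H _ _ O1) => //.
(* At fixed [x1] the maximum gives [w s x1 - w t1 x1 <= phi s x1 - phi t1 x1 <= - c * (s - t1)] for
   later [s], hence the bound on the right derivative. *)
have [d' d'0 Hd'] := Om_time_nbhs cz O1.
apply: (right_deriv_le (jt _ _ O1) d'0) => s /andP[ts sd].
have Os : Om T z m (s, x1) by apply: Hd'; rewrite (ltW ts).
have := pt _ _ _ O1 Os (ltW ts).
have := max1 _ _ (Om_Om_bar Os).
by rewrite /=; lra.
Qed.

(** * Barriers and the Lipschitz bound in space *)

Definition logb (R : realType) (A B s : R) : R := A * ln (1 + B * s).

(** The affine argument with [e = 1] or [e = -1] covers the distances to both lateral edges and,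
    later, both variables of [x - y]. *)
Lemma is_derive_logb (R : realType) (A B e k x : R) :
  0 < 1 + B * (e * x + k) ->
  is_derive x (1 : R) (fun y => logb A B (e * y + k))
    (e * (A * B / (1 + B * (e * x + k)))).
Proof.
move=> h.
have d1 : is_derive x (1 : R) (fun y : R => 1 + B * (e * y + k)) (B * e).
  by apply: is_derive_eq; rewrite /GRing.scale/=; ring.
have d2 := @is_derive1_comp _ (@ln R) _ x _ _ (is_derive1_ln h) d1.
rewrite /logb; apply: (is_derive_eq (is_deriveZ A d2)).
by rewrite /GRing.scale/=; field; rewrite gt_eqF.
Qed.

Lemma is_derive2_logb (R : realType) (A B e k x : R) :
  0 < 1 + B * (e * x + k) ->
  is_derive x (1 : R) (fun y => e * (A * B / (1 + B * (e * y + k))))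
    (- (e ^+ 2 * (A * B ^+ 2 / (1 + B * (e * x + k)) ^+ 2))).
Proof.
move=> h.
have d1 : is_derive x (1 : R) (fun y : R => 1 + B * (e * y + k)) (B * e).
  by apply: is_derive_eq; rewrite /GRing.scale/=; ring.
have h0 : 1 + B * (e * x + k) != 0 by rewrite gt_eqF.
have d2 := @is_deriveV _ (fun y : R => 1 + B * (e * y + k)) _ _ _ h0 d1.
have d3 := is_deriveZ (e * (A * B)) d2.
rewrite [X in is_derive _ _ X _](_ : _ =
  (e * (A * B)) *: (fun y : R => (1 + B * (e * y + k))^-1)); last first.
  by apply/funext => y; rewrite /GRing.scale/= mulrA.
apply: (is_derive_eq d3).
by rewrite /GRing.scale/=; field.
Qed.

Lemma logb_le (R : realType) (A B s : R) :
  0 < A -> 0 < B -> 0 <= s -> logb A B s <= A * B * s.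
Proof.
move=> A0 B0 s0; rewrite /logb -mulrA ler_pM2l//; apply: le_ln1Dx.
by apply: (lt_le_trans (ltrN10 _)); rewrite mulr_ge0// ltW.
Qed.

(** [logb] is concave and vanishes at 0, so its chord slope over [[0, s]] is at least its slope at
    [s]. A lower bound on the slope thus makes [logb] dominate linear boundary data. *)
Lemma logb_ge (R : realType) (A B s : R) :
  0 < A -> 0 < B -> 0 <= s -> A * B / (1 + B * s) * s <= logb A B s.
Proof.
move=> A0 B0 s0; have Bs : 0 <= B * s by rewrite mulr_ge0// ltW.
have h : 0 < 1 + B * s by lra.
have -> : A * B / (1 + B * s) * s = A * (B * s / (1 + B * s)).
  by field; rewrite gt_eqF.
rewrite /logb ler_pM2l// -lerN2 -lnV ?posrE//.
set q := B * s / (1 + B * s).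
have -> : (1 + B * s)^-1 = 1 + - q by rewrite /q; field; rewrite gt_eqF.
apply: le_ln1Dx; rewrite ltrN2 /q ltr_pdivrMr//; lra.
Qed.

Lemma ler_logb (R : realType) (A B s t : R) :
  0 < A -> 0 < B -> 0 <= s -> s <= t -> logb A B s <= logb A B t.
Proof.
move=> A0 B0 s0 st; rewrite /logb ler_pM2l//.
have Bs : 0 <= B * s by rewrite mulr_ge0// ltW.
have Bst : B * s <= B * t by rewrite ler_pM2l.
by rewrite ler_ln ?posrE; lra.
Qed.

(* phi = logb A B solves phi'' = - phi'^2 / A: a small A beats gradient terms of
   quadratic growth, and a large B makes phi reach the height M on a short
   interval while staying steep. *)
Lemma barrier_exists (R : realType) (c M L : R) :
  0 < c -> 0 < M -> 1 <= L ->
  exists A B s0 : R, [/\ 0 < A, 0 < B, 0 < s0, M <= logb A B s0 &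
    forall s, 0 <= s <= s0 -> L <= A * B / (1 + B * s) /\
      c * (1 + (A * B / (1 + B * s)) ^+ 2) <= A * B ^+ 2 / (1 + B * s) ^+ 2].
Proof.
move=> c0 M0 L1.
(* Then [- phi'' = 2 * c * phi' ^+ 2], which is at least [c * (1 + phi' ^+ 2)] as soon as
   [phi' >= 1]. *)
pose A := (2 * c)^-1.
have A0 : 0 < A by rewrite invr_gt0; lra.
(* [E] is the value of [1 + B * s0] at which [logb] equals [M]; the choice of [B] then makes the
   slope at [s0], namely [A * B / E], equal to [L]. *)
pose E := expR (M / A).
have E1 : 1 < E by rewrite expR_gt1 divr_gt0.
pose B := E * L / A.
have B0 : 0 < B by rewrite divr_gt0// mulr_gt0//; lra.
exists A, B, ((E - 1) / B); split => //.
- by rewrite divr_gt0//; lra.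
- rewrite /logb [B * _]mulrC divfK ?gt_eqF// addrC subrK expRK mulrC divfK//.
  by rewrite gt_eqF.
move=> s /andP[s0]; rewrite ler_pdivlMr// => hs.
have Bs : 0 <= s * B by rewrite mulr_ge0// ltW.
rewrite (mulrC B s).
have D0 : 0 < 1 + s * B by lra.
have p1 : L <= A * B / (1 + s * B).
  have -> : A * B = E * L by rewrite /B [A * _]mulrC divfK ?gt_eqF.
  by rewrite ler_pdivlMr// mulrC ler_pM2r; lra.
split => //.
have -> : A * B ^+ 2 / (1 + s * B) ^+ 2 = 2 * c * (A * B / (1 + s * B)) ^+ 2.
  by rewrite /A; field; rewrite !gt_eqF//; lra.
set q := (_ / _) ^+ 2.
have q1 : 1 <= q by rewrite expr_ge1//; lra.
by have := ler_wpM2l (ltW c0) q1; lra.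
Qed.

(* e = 1, rho = - z and e = - 1, rho = m give the distances to the two lateral
   boundaries; both are nonincreasing in time. *)
Lemma lateral_barrier (R : realType) (k0 k1 C M : R) :
  0 < k0 -> 0 < k1 -> 0 <= C -> 0 < M ->
  exists2 L, 0 < L &
  forall (T : R) (z : R -> R) (m : nat) (a b : R -> R)
    (w wt wx wxx : R -> R -> R) (e : R) (rho : R -> R),
  continuous z -> (forall t, 0 <= z t) ->
  {within Om_bar T z m, continuous (fun q : R * R => w q.1 q.2)} ->
  jets (Om T z m) w wt wx wxx ->
  (forall t x, Om T z m (t, x) -> k0 <= a x /\ `|b x| <= k1) ->
  (forall t x, Om_bar T z m (t, x) -> w t x <= M) ->
  (forall t x, Om_bar T z m (t, x) -> t = T \/ x = z t \/ x = m%:R -> w t x <= 0) ->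
  (forall t x, Om T z m (t, x) ->
     - (C * (1 + wx t x ^+ 2)) <= wt t x + a x * wxx t x + b x * wx t x) ->
  e ^+ 2 = 1 -> continuous rho -> (forall s t, s <= t -> rho t <= rho s) ->
  (forall t x, Om_bar T z m (t, x) -> 0 <= e * x + rho t) ->
  forall t x, Om_bar T z m (t, x) -> w t x <= L * (e * x + rho t).
Proof.
move=> k00 k10 C0 M0.
(* Multiplied by the ellipticity [k0], the concavity of the barrier has to beat [C * (1 + p ^+ 2)]
   and the drift [k1 * p <= k1 * (1 + p ^+ 2)]; the summand 1 makes this strict. *)
have c0 : 0 < (C + k1 + 1) / k0 by rewrite divr_gt0//; lra.
have [A [B [s0 [A0 B0 s00 Ms0 Hb]]]] := barrier_exists c0 M0 (lexx 1).
exists (A * B); first exact: mulr_gt0.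
move=> T z m a b w wt wx wxx e rho cz z0 cw jw Hab wM wbd Hw e1 crho rhon d0 t x tx.
apply: (le_trans _ (logb_le A0 B0 (d0 _ _ tx))).
have D0 t' x' : Om_bar T z m (t', x') -> 0 < 1 + B * (e * x' + rho t').
  by move=> /d0 h; have := mulr_ge0 (ltW B0) h; lra.
move: t x tx.
apply: (@comparison _ T 0 z m w wt wx wxx (fun t x => logb A B (e * x + rho t)) _ _
  cz z0 cw _ jw (fun t x O => is_derive_logb A (D0 _ _ (Om_Om_bar O)))
  (fun t x O => is_derive2_logb A (D0 _ _ (Om_Om_bar O)))).
- apply/subspace_continuousP => -[t x] tx; rewrite /logb.
  apply: cvgM; first exact: cvg_cst.
  apply: (@continuous_cvg _ _ _ _ _ (fun q : R * R => 1 + B * (e * q.2 + rho q.1))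
    (@ln R)); first exact: continuous_ln (D0 _ _ tx).
  apply: cvg_within_filter.
  apply: cvgD; first exact: cvg_cst.
  apply: cvgM; first exact: cvg_cst.
  apply: cvgD; first by apply: cvgM; [exact: cvg_cst|exact: cvg_snd].
  by apply: (cvg_comp _ _ (@cvg_fst _ _ _ _ _)); exact: crho.
- move=> s t x Os Ot st; rewrite mul0r subr0; apply: ler_logb => //.
    exact: d0 (Om_Om_bar Ot).
  by rewrite lerD2l rhon.
- move=> t x tx bd; apply: (le_trans (wbd _ _ tx bd)).
  have h := d0 _ _ tx; apply: le_trans (logb_ge A0 B0 h).
  by rewrite mulr_ge0// ltW// divr_gt0 ?mulr_gt0// D0.
move=> t x O lw; rewrite oppr0 e1 mul1r => wt0 ewx hxx.
have tx := Om_Om_bar O; have h := d0 _ _ tx.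
(* Beyond [s0] the barrier is at least the global bound [M], so a point where [w] exceeds it lies in
   the range controlled by [Hb]. *)
have ds : e * x + rho t <= s0.
  rewrite leNgt; apply/negP => s0d.
  have := ler_logb A0 B0 (ltW s00) (ltW s0d).
  by have := wM _ _ tx; lra.
have [] := Hb (e * x + rho t) _; first by rewrite h.
move: ewx hxx; set p := A * B / _; set q := _ / _; move: p q => p q ewx hxx p1 hq.
have [ak bk] := Hab _ _ O.
have := Hw _ _ O; rewrite ewx exprMn e1 mul1r.
have {}hq : (C + k1 + 1) * (1 + p ^+ 2) <= k0 * q.
  have := ler_wpM2l (ltW k00) hq.
  by rewrite mulrA [k0 * (_ / _)]mulrC divfK ?gt_eqF.
have q0 : 0 <= q.
  rewrite -(pmulr_rge0 _ k00); apply: le_trans hq.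
  by rewrite mulr_ge0//; [lra|rewrite addr_ge0// sqr_ge0].
have h1 : a x * wxx t x <= - (k0 * q).
  apply: (@le_trans _ _ (a x * (- q))).
    by rewrite ler_wpM2l//; lra.
  by rewrite mulrN lerN2 ler_wpM2r.
have h2 : b x * (e * p) <= k1 * p.
  apply: (le_trans (ler_norm _)); rewrite !normrM.
  have -> : `|e| = 1.
    by apply/eqP; rewrite -sqrp_eq1// -normrX e1 normr1.
  rewrite mul1r (gtr0_norm (_ : 0 < p)); last lra.
  by rewrite ler_wpM2r//; lra.
have h3 : k1 * p <= k1 * (1 + p ^+ 2) by rewrite ler_pM2l//; nra.
have h4 : 0 <= p ^+ 2 by exact: sqr_ge0.
move=> h5; lra.
Qed.

(** * Doubling the space variable *)

(** Both points share one time, so a maximum gives a sign to the difference of their time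
    derivatives; the order [q.2.1 <= q.2.2] turns the distance into the smooth function
    [q.2.2 - q.2.1]. *)
Lemma Om_bar2_compact (R : realType) (T : R) (z : R -> R) (m : nat) :
  continuous z -> (forall t, 0 <= z t) ->
  compact [set q : R * (R * R) | [/\ Om_bar T z m (q.1, q.2.1),
                                    Om_bar T z m (q.1, q.2.2) & q.2.1 <= q.2.2]].
Proof.
move=> cz z0.
have cK : compact (`[0, T]%classic `*` (`[0, m%:R]%classic `*` `[0, m%:R]%classic)
    : set (R * (R * R))).
  by do 2!(apply: compact_setX; first exact: segment_compact); exact: segment_compact.
apply: (subclosed_compact _ cK); last first.
  move=> [t [y x]] [[/= t0 /andP[zy ym]] [/= _ /andP[zx xm]] _]; rewrite !in_itv/=.
  by split => //; rewrite ym xm (le_trans (z0 t) zy) (le_trans (z0 t) zx).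
have cO := @Om_bar_closed _ T z m cz.
have -> : [set q : R * (R * R) | [/\ Om_bar T z m (q.1, q.2.1),
                                    Om_bar T z m (q.1, q.2.2) & q.2.1 <= q.2.2]] =
    (fun q : R * (R * R) => (q.1, q.2.1)) @^-1` Om_bar T z m `&`
    (fun q : R * (R * R) => (q.1, q.2.2)) @^-1` Om_bar T z m `&`
    (fun q : R * (R * R) => q.2.2 - q.2.1) @^-1` `[0, +oo[.
  apply/seteqP; split => q /=; rewrite in_itv/= andbT subr_ge0; first by case.
  by move=> [[]].
have c1 : continuous (fun q : R * (R * R) => q.2.1).
  by move=> q; apply: (cvg_comp _ _ (@cvg_snd _ _ _ _ _)); exact: cvg_fst.
have c2 : continuous (fun q : R * (R * R) => q.2.2).
  by move=> q; apply: (cvg_comp _ _ (@cvg_snd _ _ _ _ _)); exact: cvg_snd.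
apply: closedI; first apply: closedI.
- apply: preimage_closed => // q _.
  exact: (cvg_pair cvg_fst (c1 q)).
- apply: preimage_closed => // q _.
  exact: (cvg_pair cvg_fst (c2 q)).
- apply: preimage_closed; last exact: interval_closed.
  by move=> q _; apply: cvgB; [exact: c2|exact: c1].
Qed.

(* The one-dimensional Ishii-Lions argument: at an interior maximum of
   u t x - u t y - phi (x - y) both gradients equal phi' (x - y), so H cancels
   and only the strict concavity of phi is left to absorb F and the drift. *)
Lemma space_lipschitz (R : realType) (k0 k1 C M L1 : R) :
  0 < k0 -> 0 < k1 -> 0 <= C -> 0 < M -> 1 <= L1 ->
  exists2 L, 0 < L &
  forall (T : R) (z : R -> R) (m : nat) (a b H : R -> R)
    (u ut ux uxx F : R -> R -> R),
  continuous z -> (forall t, 0 <= z t) ->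
  {within Om_bar T z m, continuous (fun q : R * R => u q.1 q.2)} ->
  jets (Om T z m) u ut ux uxx ->
  (forall t x, Om T z m (t, x) -> k0 <= a x /\ `|b x| <= k1) ->
  (forall t x, Om T z m (t, x) -> `|F t x| <= C) ->
  (forall t x, Om T z m (t, x) ->
     ut t x + a x * uxx t x + b x * ux t x = F t x + H (ux t x)) ->
  (forall t x y, Om_bar T z m (t, x) -> Om_bar T z m (t, y) ->
     u t x - u t y <= M) ->
  (forall t x y, Om_bar T z m (t, x) -> Om_bar T z m (t, y) -> y <= x ->
     t = T \/ y = z t \/ x = m%:R -> u t x - u t y <= L1 * (x - y)) ->
  forall t x y, Om_bar T z m (t, x) -> Om_bar T z m (t, y) -> y <= x ->
     u t x - u t y <= L * (x - y).
Proof.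
move=> k00 k10 C0 M0 L11.
have c0 : 0 < (C + k1 + 1) / k0 by rewrite divr_gt0//; lra.
have [A [B [s0 [A0 B0 s00 Ms0 Hb]]]] := barrier_exists c0 M0 L11.
exists (A * B); first exact: mulr_gt0.
move=> T z m a b H u ut ux uxx F cz z0 cu [jt jx jxx] Hab HF pde uM bd t x y tx ty yx.
have xy0 : 0 <= x - y by rewrite subr_ge0.
apply: (le_trans _ (logb_le A0 B0 xy0)).
have D0 (x' y' : R) : y' <= x' -> 0 < 1 + B * (1 * x' + - y').
  by move=> h; have := mulr_ge0 (ltW B0) (_ : 0 <= 1 * x' - y'); lra.
pose K := [set q : R * (R * R) | [/\ Om_bar T z m (q.1, q.2.1),
                                    Om_bar T z m (q.1, q.2.2) & q.2.1 <= q.2.2]].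
have cK : compact K by exact: Om_bar2_compact.
pose Phi (q : R * (R * R)) := u q.1 q.2.2 - u q.1 q.2.1 - logb A B (q.2.2 - q.2.1).
have c1 : continuous (fun q : R * (R * R) => q.2.1).
  by move=> q; apply: (cvg_comp _ _ (@cvg_snd _ _ _ _ _)); exact: cvg_fst.
have c2 : continuous (fun q : R * (R * R) => q.2.2).
  by move=> q; apply: (cvg_comp _ _ (@cvg_snd _ _ _ _ _)); exact: cvg_snd.
have cPhi : {within K, continuous Phi}.
  apply/subspace_continuousP => -[t' [y' x']] [/= Oy Ox yx'].
  move/subspace_continuousP : cu => cu.
  (* [u] is continuous only relative to [Om_bar], so composing with a projection uses that it maps
     [K] into [Om_bar]. *)
  have cP (p : R * (R * R) -> R) : continuous p ->
      (forall q, K q -> Om_bar T z m (q.1, p q)) ->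
      K (t', (y', x')) ->
      u q.1 (p q) @[q --> within K (nbhs (t', (y', x')))] -->
        u t' (p (t', (y', x'))).
    move=> cp Kp Kt.
    apply: (cvg_trans _ (cu _ (Kp _ Kt))) => A' /=.
    rewrite /fmap/within/= => hA.
    have cpair : (fun q : R * (R * R) => (q.1, p q)) @ nbhs (t', (y', x')) -->
        nbhs (t', p (t', (y', x'))).
      exact: (cvg_pair cvg_fst (cp _)).
    have h1 : nbhs (t', (y', x'))
      (fun q => Om_bar T z m (q.1, p q) -> A' (u q.1 (p q))) := cpair _ hA.
    change (nbhs (t', (y', x')) (fun q => K q -> A' (u q.1 (p q)))).
    by apply: filterS h1 => q h /Kp /h.
  apply: cvgB; first apply: cvgB.
  - by apply: (cP (fun q => q.2.2)) => // q [].
  - by apply: (cP (fun q => q.2.1)) => // q [].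
  rewrite /logb; apply: cvgM; first exact: cvg_cst.
  apply: (@continuous_cvg _ _ _ _ _ (fun q : R * (R * R) => 1 + B * (q.2.2 - q.2.1))
    (@ln R)); first by apply: continuous_ln; have := D0 _ _ yx'; rewrite mul1r.
  apply: cvg_within_filter.
  apply: cvgD; first exact: cvg_cst.
  apply: cvgM; first exact: cvg_cst.
  by apply: cvgB; [exact: c2|exact: c1].
have ne : K !=set0 by exists (t, (y, x)).
have [[t1 [y1 x1]] K1 max1] := compact_EVT_max ne cK cPhi.
have {K1}[/= Oy1 Ox1 yx1] : K (t1, (y1, x1)) by rewrite inE in K1.
have {}max1 s y' x' : Om_bar T z m (s, y') -> Om_bar T z m (s, x') -> y' <= x' ->
   u s x' - u s y' - logb A B (x' - y') <= u t1 x1 - u t1 y1 - logb A B (x1 - y1).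
  by move=> h1 h2 h3; apply: (max1 (s, (y', x'))); rewrite inE.
have [le1|lt1] := leP (u t1 x1 - u t1 y1) (logb A B (x1 - y1)).
  by have := max1 _ _ _ ty tx yx; lra.
exfalso.
have xy1 : 0 <= x1 - y1 by lra.
have ds : x1 - y1 <= s0.
  rewrite leNgt; apply/negP => s0d.
  have := ler_logb A0 B0 (ltW s00) (ltW s0d).
  by have := uM _ _ _ Ox1 Oy1; lra.
have [] := Hb (x1 - y1) _; first by rewrite xy1.
move=> p1 hq.
have lge := logb_ge A0 B0 xy1.
(* The slope of the barrier is at least [L1], so by [lge] it dominates the boundary bound. The cases
   [x1 = z t1] and [y1 = m] need no data: the order [y1 < x1] excludes them below. *)
have nb : ~ (t1 = T \/ y1 = z t1 \/ x1 = m%:R).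
  move=> /(bd _ _ _ Ox1 Oy1 yx1) h.
  by have := ler_wpM2r xy1 p1; lra.
have yx1' : y1 < x1.
  rewrite lt_neqAle yx1 andbT; apply/eqP => e.
  by move: lt1; rewrite e !subrr /logb mulr0 addr0 ln1 mulr0 ltxx.
have [Px Py] : Om T z m (t1, x1) /\ Om T z m (t1, y1).
  move: Oy1 Ox1 => [/= /andP[t10 t1T] /andP[zy ym]] [/= _ /andP[zx xm]].
  have t1T' : t1 < T by rewrite lt_neqAle t1T andbT; apply/eqP => e; apply: nb; left.
  have zy' : z t1 < y1.
    by rewrite lt_neqAle zy andbT; apply/eqP => e; apply: nb; right; left.
  have xm' : x1 < m%:R.
    by rewrite lt_neqAle xm andbT; apply/eqP => e; apply: nb; right; right.
  have z00 := z0 t1.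
  have y10 := le_lt_trans z00 zy'.
  split; split => /=.
  - by split => /=; [rewrite t10|exact: lt_trans yx1'].
  - by rewrite xm' (lt_trans zy').
  - by split => /=; [rewrite t10|].
  - by rewrite zy' (lt_trans yx1').
have [d d0 Hd] := Om_space_nbhs Px.
have [d' d'0 Hd'] := Om_space_nbhs Py.
set p := A * B / (1 + B * (x1 - y1)) in p1 hq lge.
set q := A * B ^+ 2 / (1 + B * (x1 - y1)) ^+ 2 in hq.
(* First [y1] is frozen, giving [uxx <= - q] at [x1]; then [x1] is frozen, giving [uxx >= q] at
   [y1]. The radius bound [x1 - y1] preserves the order of the two points. *)
have [] := @local_max_deriv2 _ (fun x' => u t1 x' - logb A B (1 * x' + - y1))
   (fun x' => ux t1 x' - 1 * (A * B / (1 + B * (1 * x' + - y1)))) x1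
   (Num.min d (x1 - y1)) (uxx t1 x1 + q).
- by rewrite lt_min d0 subr_gt0.
- move=> x'; rewrite lt_min => /andP[/Hd Ox' /ltr_normlP[h1 h2]].
  apply: is_deriveB (jx _ _ Ox') (is_derive_logb _ _); apply: D0; lra.
- have -> : uxx t1 x1 + q = uxx t1 x1 -
     - (1 ^+ 2 * (A * B ^+ 2 / (1 + B * (1 * x1 + - y1)) ^+ 2)).
    by rewrite opprK expr1n !mul1r.
  exact: is_deriveB (jxx _ _ Px) (is_derive2_logb _ (D0 _ _ yx1)).
- move=> x'; rewrite lt_min => /andP[/Hd Ox' /ltr_normlP[h1 h2]].
  have := max1 _ _ _ Oy1 (Om_Om_bar Ox') _; rewrite !mul1r => h.
  have {}h := h _; have h3 : y1 <= x' by lra.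
  by have := h h3; lra.
rewrite !mul1r -/p => ex exx.
have [] := @local_max_deriv2 _ (fun y' => - u t1 y' - logb A B (- 1 * y' + x1))
   (fun y' => - ux t1 y' - - 1 * (A * B / (1 + B * (- 1 * y' + x1)))) y1
   (Num.min d' (x1 - y1)) (- uxx t1 y1 + q).
- by rewrite lt_min d'0 subr_gt0.
- move=> y'; rewrite lt_min => /andP[/Hd' Oy' /ltr_normlP[h1 h2]].
  apply: is_deriveB (is_deriveN (jx _ _ Oy')) (is_derive_logb _ _).
  have h : 0 <= - 1 * y' + x1 by lra.
  by have := mulr_ge0 (ltW B0) h; lra.
- have -> : - uxx t1 y1 + q = - uxx t1 y1 -
     - ((-1) ^+ 2 * (A * B ^+ 2 / (1 + B * (-1 * y1 + x1)) ^+ 2)).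
    by rewrite opprK sqrrN expr1n mulN1r mul1r [- y1 + x1]addrC.
  apply: is_deriveB (is_deriveN (jxx _ _ Py)) (is_derive2_logb _ _).
  have h : 0 <= - 1 * y1 + x1 by lra.
  by have := mulr_ge0 (ltW B0) h; lra.
- move=> y'; rewrite lt_min => /andP[/Hd' Oy' /ltr_normlP[h1 h2]].
  have h3 : y' <= x1 by lra.
  have := max1 _ _ _ (Om_Om_bar Oy') Ox1 h3.
  by rewrite !mulN1r ![- _ + x1]addrC; lra.
rewrite !mulN1r opprK [- y1 + x1]addrC -/p => ey eyy.
have et : ut t1 x1 - ut t1 y1 <= 0.
  have [d1 d10 Hd1] := Om_time_nbhs cz Px.
  have [d2 d20 Hd2] := Om_time_nbhs cz Py.
  have e0 : 0 < Num.min d1 d2 by rewrite lt_min d10.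
  apply: (right_deriv_le (right_derivB (jt _ _ Px) (jt _ _ Py)) e0).
  move=> s /andP[ts]; rewrite -ltrBlDl lt_min => /andP[s1 s2].
  have Osx : Om T z m (s, x1) by apply: Hd1; lra.
  have Osy : Om T z m (s, y1) by apply: Hd2; lra.
  by have := max1 _ _ _ (Om_Om_bar Osy) (Om_Om_bar Osx) yx1; rewrite mul0r; lra.
(* Subtracting the equation at [y1] from the one at [x1] cancels [H p] and leaves
   [- 2 C <= - 2 k0 q + 2 k1 p], which the lower bound [hq] on [q] contradicts. *)
have [ax bx] := Hab _ _ Px; have [ay by_] := Hab _ _ Py.
have Fx := HF _ _ Px; have Fy := HF _ _ Py.
have Ex := pde _ _ Px; have Ey := pde _ _ Py.
have uxp : ux t1 x1 = p by clear - ex; lra.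
have uyp : ux t1 y1 = p by clear - ey; lra.
rewrite uxp in Ex; rewrite uyp in Ey.
move: p q p1 hq {lge} exx eyy Ex Ey {ex ey uxp uyp} => p q p1 hq exx eyy Ex Ey.
clear - k00 k10 C0 L11 ax bx ay by_ Fx Fy Ex Ey exx eyy et p1 hq.
have {}hq : (C + k1 + 1) * (1 + p ^+ 2) <= k0 * q.
  have := ler_wpM2l (ltW k00) hq.
  by rewrite mulrA [k0 * (_ / _)]mulrC divfK ?gt_eqF.
have p20 : 0 <= p ^+ 2 by exact: sqr_ge0.
have q0 : 0 <= q.
  by rewrite -(pmulr_rge0 _ k00); apply: le_trans hq; rewrite mulr_ge0//; lra.
have a1 : a x1 * uxx t1 x1 <= - (k0 * q).
  apply: (@le_trans _ _ (a x1 * (- q))); first by rewrite ler_wpM2l//; lra.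
  by rewrite mulrN lerN2 ler_wpM2r.
have a2 : k0 * q <= a y1 * uxx t1 y1.
  apply: (@le_trans _ _ (a y1 * q)); first by rewrite ler_wpM2r.
  by rewrite ler_wpM2l//; lra.
have b1 : b x1 * p <= k1 * p.
  by rewrite ler_wpM2r//; [lra|apply: le_trans bx; exact: ler_norm].
have b2 : - (k1 * p) <= b y1 * p.
  by rewrite -mulNr ler_wpM2r//; [lra|have /ler_normlP[] := by_; lra].
have h3 : k1 * p <= k1 * (1 + p ^+ 2) by rewrite ler_pM2l//; nra.
have h4 : 0 <= C * p ^+ 2 by rewrite mulr_ge0.
have /ler_normlP[f1 f2] := Fx; have /ler_normlP[f3 f4] := Fy.
lra.
Qed.

(** * Regularity in time *)

Lemma Om_barW (R : realType) (S T : R) (z : R -> R) (m : nat) :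
  S <= T -> Om_bar S z m `<=` Om_bar T z m.
Proof. by move=> ST [t x] [/= /andP[t0 tS] h]; split => //=; rewrite t0 (le_trans tS). Qed.

Lemma OmW (R : realType) (S T : R) (z : R -> R) (m : nat) :
  S <= T -> Om S z m `<=` Om T z m.
Proof.
move=> ST [t x] [[/= /andP[t0 tS] x0] h]; split => //=; split => //=.
by rewrite t0 (lt_le_trans tS).
Qed.

(** At time [t2] a paraboloid lies above the cone of slope [L] at the price [eta], by Young's
    inequality; going back in time it rises fast enough to stay a supersolution. Its curvature,
    hence the rate, grows like [1 / eta], so [eta] is left free to be balanced against [t2 - t1]. *)
Lemma time_modulus (R : realType) (T k1 C L Cl eta : R) (z : R -> R) (m : nat)
    (a : R -> R) (w wt wx wxx : R -> R -> R) (t1 t2 x0 : R) :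
  continuous z -> (forall t, 0 <= z t) ->
  {within Om_bar T z m, continuous (fun q : R * R => w q.1 q.2)} ->
  jets (Om T z m) w wt wx wxx ->
  (forall t x, Om T z m (t, x) -> 0 <= a x <= k1) ->
  (forall t x, Om T z m (t, x) -> - C <= wt t x + a x * wxx t x) ->
  0 <= C -> 0 <= Cl -> 0 <= k1 -> 0 < eta ->
  (forall x, Om_bar T z m (t2, x) -> w t2 x <= w t2 x0 + L * `|x - x0|) ->
  (forall t x, Om_bar T z m (t, x) -> t <= t2 -> x = z t \/ x = m%:R ->
     w t x <= w t2 x0 + L * `|x - x0| + Cl * (t2 - t)) ->
  Om_bar T z m (t1, x0) -> t1 <= t2 -> t2 <= T ->
  w t1 x0 - w t2 x0 <= eta + (C + Cl + 1 + k1 * (L ^+ 2 / (2 * eta))) * (t2 - t1).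
Proof.
move=> cz z0 cw jw Ha Hw C0 Cl0 k10 eta0 wt2 wl tx1 t12 t2T.
pose beta := L ^+ 2 / (4 * eta).
have beta0 : 0 <= beta by rewrite divr_ge0 ?sqr_ge0//; lra.
(* [Cl] pays for the lateral data, [C] and the last term for the equation with [phixx = 2 * beta];
   the 1 makes the supersolution strict. *)
pose c := C + Cl + 1 + k1 * (L ^+ 2 / (2 * eta)).
have cE : c = C + Cl + 1 + k1 * (2 * beta).
  by rewrite /c /beta; congr (_ + _ * _); field; rewrite gt_eqF.
have k1b : 0 <= k1 * (2 * beta) by rewrite mulr_ge0//; lra.
pose phi t x := w t2 x0 + eta + beta * (x - x0) ^+ 2 + c * (t2 - t).
have young s : L * `|s| <= eta + beta * s ^+ 2.
  rewrite -subr_ge0; have -> : eta + beta * s ^+ 2 - L * `|s| =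
      (2 * eta - L * `|s|) ^+ 2 / (4 * eta).
    by rewrite /beta -(real_normK (num_real s)); field; rewrite gt_eqF.
  by rewrite divr_ge0 ?sqr_ge0//; lra.
have tx1' : Om_bar t2 z m (t1, x0).
  by move: tx1 => [/= /andP[t10 _] h]; split => //=; rewrite t10.
suff : w t1 x0 <= phi t1 x0.
  by rewrite /phi subrr expr0n/= mulr0 -/c; lra.
(* The domain is cut off at [t2], which becomes the terminal time. *)
apply: (@comparison _ t2 c z m w wt wx wxx phi (fun t x => 2 * beta * (x - x0))
  (fun t x => 2 * beta) cz z0) tx1'.
- by apply: continuous_subspaceW cw; exact: Om_barW.
- apply: continuous_subspaceT => q; rewrite /phi.
  apply: cvgD; first apply: cvgD; first exact: cvg_cst.
    apply: cvgM; first exact: cvg_cst.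
    by rewrite expr2; apply: cvgM; (apply: cvgB; [exact: cvg_snd|exact: cvg_cst]).
  apply: cvgM; first exact: cvg_cst.
  by apply: cvgB; [exact: cvg_cst|exact: cvg_fst].
- by apply: jets_sub jw; exact: OmW.
- move=> t x _; apply: is_derive_eq; rewrite /GRing.scale/=; ring.
- move=> t x _; apply: is_derive_eq; rewrite /GRing.scale/=; ring.
- by move=> s t x _ _ st; rewrite /phi; lra.
- move=> t x tx bd.
  have y := young (x - x0).
  have t2t : 0 <= t2 - t by move: tx => [/= /andP[]]; lra.
  have Clc : Cl * (t2 - t) <= c * (t2 - t) by rewrite ler_wpM2r//; lra.
  have c0 : 0 <= c * (t2 - t) by rewrite mulr_ge0//; lra.
  case: bd => [t_|bd].
    have := wt2 x; rewrite -t_ => /(_ (Om_barW t2T tx)); rewrite /phi t_; lra.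
  by have := wl _ _ (Om_barW t2T tx) _ bd; rewrite /phi => h; have := h _; lra.
- move=> t x Ox _ h1 h2 h3; have {}Ox := OmW t2T Ox.
  have /andP[ax0 axk] := Ha _ _ Ox; have := Hw _ _ Ox.
  have : a x * wxx t x <= k1 * (2 * beta).
    apply: (@le_trans _ _ (a x * (2 * beta))); first by rewrite ler_wpM2l.
    by rewrite ler_wpM2r//; lra.
  lra.
Qed.

Lemma is_derive_lip (R : realType) (f : R -> R) (x l L d : R) :
  0 < d -> is_derive x (1 : R) f l ->
  (forall y, `|y - x| < d -> `|f y - f x| <= L * `|y - x|) -> `|l| <= L.
Proof.
move=> d0 [df vf] H.
have : (fun h : R => h^-1 *: ((f \o shift x) (h *: 1) - f x)) @ 0^' --> l.
  by rewrite -vf; exact: df.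
move/cvg_norm => Hn; apply: (cvgr_to_le Hn).
near=> h.
have h0 : h != 0 by near: h; exact: nbhs_dnbhs_neq.
have hd : `|h| < d by near: h; exact: dnbhs0_lt.
rewrite /GRing.scale/= mulr1 normrM normfV ler_pdivrMl ?normr_gt0// mulrC.
by have := H (h + x); rewrite addrK; exact.
Unshelve. all: by end_near.
Qed.

Lemma uniform_within_continuous (R : realType) (D : set (R * R)) (f : R -> R -> R) :
  (forall e, 0 < e -> exists2 d, 0 < d & forall p q, D p -> D q ->
     `|p.1 - q.1| < d -> `|p.2 - q.2| < d -> `|f p.1 p.2 - f q.1 q.2| < e) ->
  {within D, continuous (fun q : R * R => f q.1 q.2)}.
Proof.
move=> H; apply/subspace_continuousP => p Dp; apply/cvgrPdist_lt => e e0.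
have [d d0 Hd] := H _ e0.
rewrite near_withinE; apply/nbhs_ballP; exists d => //= q [h1 h2] Dq.
exact: Hd.
Qed.

(** * Quasilinear equations with quadratic gradient growth *)

(** A single [K] carries all bounds, so constants built from [k0] and [K] are uniform over the whole
    class. [H] sees only the gradient, which lets it cancel between two points with equal
    gradients. *)
Record quasilinear_problem (R : realType) (k0 K T : R) (z : R -> R) (m : nat)
    (a b H : R -> R) (G Gt Gx Gxx F u ut ux uxx : R -> R -> R) : Prop := {
  ql_z_cont : continuous z ;
  ql_z_ge0 : forall t, 0 <= z t ;
  ql_z_nondecr : forall s t, s <= t -> z s <= z t ;
  ql_u_cont : {within Om_bar T z m, continuous (fun q : R * R => u q.1 q.2)} ;
  ql_u_jets : jets (Om T z m) u ut ux uxx ;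
  ql_u_bound : forall t x, Om_bar T z m (t, x) -> `|u t x| <= K ;
  ql_G_jets : jets (Om T z m) G Gt Gx Gxx ;
  ql_G_bound : forall t x, Om_bar T z m (t, x) -> `|G t x| <= K ;
  ql_G_lip : forall t x s y, Obar T (t, x) -> Obar T (s, y) ->
    `|G t x - G s y| <= K * (`|x - y| + `|t - s|) ;
  ql_dG_bound : forall t x, Om T z m (t, x) ->
    [/\ `|Gt t x| <= K, `|Gx t x| <= K & `|Gxx t x| <= K] ;
  ql_coef : forall t x, Om T z m (t, x) -> k0 <= a x <= K /\ `|b x| <= K ;
  ql_F_bound : forall t x, Om T z m (t, x) -> `|F t x| <= K ;
  ql_H_bound : forall q, `|H q| <= K * (1 + q ^+ 2) ;
  ql_eq : forall t x, Om T z m (t, x) ->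
    ut t x + a x * uxx t x + b x * ux t x = F t x + H (ux t x) ;
  ql_bd : forall t x, Om_bar T z m (t, x) -> t = T \/ x = z t \/ x = m%:R ->
    u t x = G t x
}.

(** The class is closed under negation of [u], so every two-sided estimate below reduces to a
    one-sided one. The form [-1 * _] is that of [jetsZ]. *)
Lemma quasilinear_problemN (R : realType) (k0 K T : R) (z : R -> R) (m : nat)
    (a b H : R -> R) (G Gt Gx Gxx F u ut ux uxx : R -> R -> R) :
  quasilinear_problem k0 K T z m a b H G Gt Gx Gxx F u ut ux uxx ->
  quasilinear_problem k0 K T z m a b (fun q => - H (- q))
    (fun t x => -1 * G t x) (fun t x => -1 * Gt t x) (fun t x => -1 * Gx t x)
    (fun t x => -1 * Gxx t x) (fun t x => - F t x)
    (fun t x => -1 * u t x) (fun t x => -1 * ut t x) (fun t x => -1 * ux t x)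
    (fun t x => -1 * uxx t x).
Proof.
move=> [h1 h2 h3 h4 h5 h6 h7 h8 h9 h10 h11 h12 h13 h14 h15]; split.
- exact: h1.
- exact: h2.
- exact: h3.
- by move=> q; apply: cvgM; [exact: cvg_cst|exact: h4].
- exact: jetsZ h5.
- by move=> t x /h6; rewrite mulN1r normrN.
- exact: jetsZ h7.
- by move=> t x /h8; rewrite mulN1r normrN.
- by move=> t x s y tx sy; rewrite -mulrBr mulN1r normrN; exact: h9.
- by move=> t x /h10; rewrite !mulN1r !normrN.
- exact: h11.
- by move=> t x /h12; rewrite normrN.
- by move=> q; have := h13 (- q); rewrite sqrrN normrN.
- by move=> t x /h14; rewrite !mulN1r opprK; lra.
- by move=> t x tx bd; rewrite (h15 _ _ tx bd).
Qed.

Lemma Om_bar_Obar (R : realType) (T : R) (z : R -> R) (m : nat) :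
  (forall t, 0 <= z t) -> Om_bar T z m `<=` Obar T.
Proof.
move=> z0 [t x] [/= tT /andP[zx _]]; split => //=.
exact: le_trans (z0 t) zx.
Qed.

Lemma lip_within_continuous (R : realType) (D : set (R * R)) (K : R)
    (f : R -> R -> R) : 0 <= K ->
  (forall t x s y, D (t, x) -> D (s, y) ->
    `|f t x - f s y| <= K * (`|x - y| + `|t - s|)) ->
  {within D, continuous (fun q : R * R => f q.1 q.2)}.
Proof.
move=> K0 Hf; apply: uniform_within_continuous => e e0.
have K1 : 0 < 2 * (K + 1) by lra.
exists (e / (2 * (K + 1))); first by rewrite divr_gt0.
move=> [t x] [s y] p q; rewrite /= !ltr_pdivlMr// => h1 h2.
have := Hf _ _ _ _ p q.
by have := normr_ge0 (t - s); have := normr_ge0 (x - y); nra.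
Qed.

(** The difference [u - G] vanishes on the parabolic boundary and satisfies an inequality with the
    same kind of quadratic growth, so the lateral barrier applies at both edges. *)
Lemma quasilinear_lateral (R : realType) (k0 K : R) : 0 < k0 -> 1 <= K ->
  exists2 L, 0 < L &
  forall (T : R) (z : R -> R) (m : nat) (a b H : R -> R)
    (G Gt Gx Gxx F u ut ux uxx : R -> R -> R),
  quasilinear_problem k0 K T z m a b H G Gt Gx Gxx F u ut ux uxx ->
  forall t x, Om_bar T z m (t, x) ->
    `|u t x - G t x| <= L * (x - z t) /\ `|u t x - G t x| <= L * (m%:R - x).
Proof.
move=> k00 K1.
(* [3 * K] collects [F], [Gt] and the constant part of [H]; [2 * K ^+ 2] the terms with [Gx] and
   [Gxx]; the rest is [K] times the constant in [ux ^+ 2 <= 2 * v ^+ 2 + 2 * K ^+ 2]. The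
   coefficient [2 * K] of [v ^+ 2] is below [C]. *)
pose C := 3 * K + 2 * K ^+ 2 + 2 * K ^+ 3.
have K20 : 0 <= K ^+ 2 by exact: sqr_ge0.
have K30 : 0 <= K ^+ 3 by rewrite exprn_ge0//; lra.
have C0 : 0 <= C by rewrite /C; lra.
have K0 : 0 < K by lra.
have M0 : 0 < 2 * K by lra.
have [L L0 HL] := lateral_barrier k00 K0 C0 M0.
exists L => // T z m a b H G Gt Gx Gxx F u ut ux uxx P.
have one (H' : R -> R) (G' Gt' Gx' Gxx' F' u' ut' ux' uxx' : R -> R -> R) :
  quasilinear_problem k0 K T z m a b H' G' Gt' Gx' Gxx' F' u' ut' ux' uxx' ->
  forall t x, Om_bar T z m (t, x) ->
    u' t x - G' t x <= L * (x - z t) /\ u' t x - G' t x <= L * (m%:R - x).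
  move=> {}P.
  have [cz z0 zn cu ju ub jG Gb Glip dG coef Fb Hb pde bd] := P.
  have cG : {within Om_bar T z m, continuous (fun q : R * R => G' q.1 q.2)}.
    apply: (@lip_within_continuous _ _ K); first lra.
    by move=> t x s y tx sy; apply: Glip; apply: (Om_bar_Obar z0); eassumption.
  have cv : {within Om_bar T z m,
      continuous (fun q : R * R => u' q.1 q.2 - G' q.1 q.2)}.
    by move=> q; apply: cvgB; [exact: cu|exact: cG].
  have vbd t x : Om_bar T z m (t, x) -> t = T \/ x = z t \/ x = m%:R ->
      u' t x - G' t x <= 0.
    by move=> tx /(bd _ _ tx) ->; rewrite subrr.
  have coef' t x : Om T z m (t, x) -> k0 <= a x /\ `|b x| <= K.
    by move=> /coef[/andP[]].
  have vM t x : Om_bar T z m (t, x) -> u' t x - G' t x <= 2 * K.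
    by move=> tx; have /ler_normlP[] := ub _ _ tx; have /ler_normlP[] := Gb _ _ tx; lra.
  have vpde t x : Om T z m (t, x) ->
      - (C * (1 + (ux' t x - Gx' t x) ^+ 2)) <=
      (ut' t x - Gt' t x) + a x * (uxx' t x - Gxx' t x)
        + b x * (ux' t x - Gx' t x).
    move=> O; have E := pde _ _ O; have [d1 d2 d3] := dG _ _ O.
    have [/andP[ak0 aK] bK] := coef _ _ O.
    have /ler_normlP[F1 F2] := Fb _ _ O.
    have /ler_normlP[H1 H2] := Hb (ux' t x).
    have e1 : a x * Gxx' t x <= K ^+ 2.
      apply: (le_trans (ler_norm _)); rewrite normrM expr2.
      by apply: ler_pM => //; rewrite ger0_norm//; lra.
    have e2 : b x * Gx' t x <= K ^+ 2.
      by apply: (le_trans (ler_norm _)); rewrite normrM expr2; apply: ler_pM.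
    have /ler_normlP[_ e3] := d1.
    set v := ux' t x - Gx' t x.
    have sq : (ux' t x) ^+ 2 <= 2 * v ^+ 2 + 2 * K ^+ 2.
      have : (Gx' t x) ^+ 2 <= K ^+ 2.
        by rewrite -[leLHS]real_normK ?num_real// ler_pXn2r// nnegrE//; lra.
      have : 0 <= (v - Gx' t x) ^+ 2 by exact: sqr_ge0.
      by have -> : ux' t x = v + Gx' t x by [rewrite /v subrK]; lra.
    have sqK := ler_wpM2l (ltW K0) sq.
    have v2 : 0 <= (3 * K + 2 * K ^+ 2 + 2 * K ^+ 3 - 2 * K) * v ^+ 2.
      by rewrite mulr_ge0 ?sqr_ge0//; lra.
    have cube : K * K ^+ 2 = K ^+ 3 by rewrite exprS.
    by rewrite /C /v in v2 sqK *; lra.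
  have J := jetsB ju jG.
  move=> t x tx; split.
    rewrite -[x in _ * (x - _)]mul1r.
    apply: (HL T z m a b _ _ _ _ 1 (fun t => - z t) cz z0 cv J) => //.
    - exact: expr1n.
    - by move=> s; apply: cvgN; exact: cz.
    - by move=> s t' /zn; rewrite lerN2.
    - by move=> t' x' [_ /=]/andP[]; lra.
  rewrite -[- x]mulN1r [m%:R + _]addrC.
  apply: (HL T z m a b _ _ _ _ (-1) (fun=> m%:R) cz z0 cv J) => //.
  - by rewrite sqrrN expr1n.
  - by move=> s; exact: cvg_cst.
  - by move=> t' x' [_ /=]/andP[]; lra.
move=> t x tx.
have [h1 h2] := one _ _ _ _ _ _ _ _ _ _ P _ _ tx.
have [h3 h4] := one _ _ _ _ _ _ _ _ _ _ (quasilinear_problemN P) _ _ tx.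
by split; apply/ler_normlP; split; lra.
Qed.

Lemma quasilinear_space (R : realType) (k0 K : R) : 0 < k0 -> 1 <= K ->
  exists2 L, 0 < L &
  forall (T : R) (z : R -> R) (m : nat) (a b H : R -> R)
    (G Gt Gx Gxx F u ut ux uxx : R -> R -> R),
  quasilinear_problem k0 K T z m a b H G Gt Gx Gxx F u ut ux uxx ->
  forall t x y, Om_bar T z m (t, x) -> Om_bar T z m (t, y) ->
    `|u t x - u t y| <= L * `|x - y|.
Proof.
move=> k00 K1.
have [Lb Lb0 lateral] := quasilinear_lateral k00 K1.
have K0 : 0 < K by lra.
have M0 : 0 < 2 * K by lra.
(* On an edge, [u t x - u t y] is at most the barrier term [Lb * (x - y)] plus the variation
   [K * (x - y)] of [G]; the 1 meets the requirement [1 <= L1]. *)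
have L11 : 1 <= Lb + K + 1 by lra.
have [L L0 HL] := space_lipschitz k00 K0 (ltW K0) M0 L11.
exists L => // T z m a b H G Gt Gx Gxx F u ut ux uxx P.
have one (H' : R -> R) (G' Gt' Gx' Gxx' F' u' ut' ux' uxx' : R -> R -> R) :
  quasilinear_problem k0 K T z m a b H' G' Gt' Gx' Gxx' F' u' ut' ux' uxx' ->
  forall t x y, Om_bar T z m (t, x) -> Om_bar T z m (t, y) -> y <= x ->
    u' t x - u' t y <= L * (x - y).
  move=> {}P.
  have lat := lateral _ _ _ _ _ _ _ _ _ _ _ _ _ _ _ P.
  have [cz z0 zn cu ju ub jG Gb Glip dG coef Fb Hb pde bd] := P.
  apply: (HL T z m a b H' _ _ _ _ F' cz z0 cu ju) => //.
  - by move=> t x /coef[/andP[]].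
  - by move=> t x y tx ty; have /ler_normlP[] := ub _ _ tx;
      have /ler_normlP[] := ub _ _ ty; lra.
  - move=> t x y tx ty yx tb.
    have xy : 0 <= x - y by lra.
    have := Glip _ _ _ _ (Om_bar_Obar z0 tx) (Om_bar_Obar z0 ty).
    rewrite subrr normr0 addr0 (ger0_norm xy) => /ler_normlP[_ g].
    have Lxy : 0 <= Lb * (x - y) by rewrite mulr_ge0// ltW.
    case: tb => [tT|[yz|xm]].
    + by rewrite (bd _ _ tx (or_introl tT)) (bd _ _ ty (or_introl tT)); lra.
    + rewrite (bd _ _ ty (or_intror (or_introl yz))).
      by have [/ler_normlP[_ h] _] := lat _ _ tx; rewrite -yz in h; lra.
    + rewrite (bd _ _ tx (or_intror (or_intror xm))).
      by have [_ /ler_normlP[h _]] := lat _ _ ty; rewrite -xm in h; lra.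
have P' := quasilinear_problemN P.
move=> t x y tx ty.
have [yx|/ltW yx] := leP y x.
  have := one _ _ _ _ _ _ _ _ _ _ P _ _ _ tx ty yx.
  have := one _ _ _ _ _ _ _ _ _ _ P' _ _ _ tx ty yx.
  by rewrite (ger0_norm (_ : 0 <= x - y)) ?subr_ge0//= => h1 h2; apply/ler_normlP; split; lra.
have := one _ _ _ _ _ _ _ _ _ _ P _ _ _ ty tx yx.
have := one _ _ _ _ _ _ _ _ _ _ P' _ _ _ ty tx yx.
rewrite (distrC x y) (ger0_norm (_ : 0 <= y - x)) ?subr_ge0//= => h1 h2.
by apply/ler_normlP; split; lra.
Qed.

(** The space estimate bounds the gradient, so the quadratic term becomes a bounded source and
    [time_modulus] applies; [eta = sqrt (t2 - t1)] balances [eta] against [(t2 - t1) / eta]. *)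
Lemma quasilinear_time (R : realType) (k0 K : R) : 0 < k0 -> 1 <= K ->
  exists2 L, 0 < L &
  forall (T : R) (z : R -> R) (m : nat) (a b H : R -> R)
    (G Gt Gx Gxx F u ut ux uxx : R -> R -> R),
  quasilinear_problem k0 K T z m a b H G Gt Gx Gxx F u ut ux uxx ->
  forall t1 t2 x, Om_bar T z m (t1, x) -> Om_bar T z m (t2, x) ->
    t1 <= t2 -> t2 - t1 <= 1 ->
    `|u t1 x - u t2 x| <= L * Num.sqrt (t2 - t1).
Proof.
move=> k00 K1.
have [Ls Ls0 space] := quasilinear_space k00 K1.
pose L := Ls + K.
have L2 : 0 <= L ^+ 2 by exact: sqr_ge0.
pose C := 2 * K + 2 * K * L ^+ 2 + K * L.
have KL : 0 <= K * L by rewrite mulr_ge0 /L; lra.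
have KL2 : 0 <= K * L ^+ 2 by rewrite mulr_ge0//; lra.
have C0 : 0 <= C by rewrite /C; lra.
exists (2 + C + K + K * L ^+ 2); first lra.
move=> T z m a b H G Gt Gx Gxx F u ut ux uxx P t1 t2 x tx1 tx2 t12 t21.
have [<-|ne] := eqVneq t1 t2; first by rewrite !subrr normr0 sqrtr0 mulr0.
have t12' : 0 < t2 - t1 by rewrite subr_gt0 lt_neqAle ne.
pose eta := Num.sqrt (t2 - t1).
have eta0 : 0 < eta by rewrite sqrtr_gt0.
have etaE : eta ^+ 2 = t2 - t1 by rewrite sqr_sqrtr// ltW.
have eta1 : eta <= 1 by rewrite -(ler_pXn2r (isT : (0 < 2)%N)) ?nnegrE ?expr1n ?etaE// ltW.
have one (H' : R -> R) (G' Gt' Gx' Gxx' F' u' ut' ux' uxx' : R -> R -> R) :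
  quasilinear_problem k0 K T z m a b H' G' Gt' Gx' Gxx' F' u' ut' ux' uxx' ->
  u' t1 x - u' t2 x <= (2 + C + K + K * L ^+ 2) * eta.
  move=> {}P.
  have sp := space _ _ _ _ _ _ _ _ _ _ _ _ _ _ _ P.
  have [cz z0 zn cu ju ub jG Gb Glip dG coef Fb Hb pde bd] := P.
  have uxL t y : Om T z m (t, y) -> `|ux' t y| <= L.
    move=> O; have [d d0 Hd] := Om_space_nbhs O.
    apply: (is_derive_lip d0 (jets_x ju O)) => y' /Hd O'.
    apply: (le_trans (sp _ _ _ (Om_Om_bar O') (Om_Om_bar O))).
    by rewrite ler_wpM2r// /L; lra.
  have tm := @time_modulus _ T K C L K eta z m a u' ut' ux' uxx' t1 t2 x cz z0 cu ju.
  have {}tm : u' t1 x - u' t2 x <=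
      eta + (C + K + 1 + K * (L ^+ 2 / (2 * eta))) * (t2 - t1).
    have [/= /andP[_ t2T] /andP[zx xm]] := tx2.
    have K0 := le_trans ler01 K1.
    apply: tm => //.
    - by move=> t y /coef[/andP[h1 h2] _]; rewrite h2 andbT; lra.
    - move=> t y O; have E := pde _ _ O.
      have /ler_normlP[F1 F2] := Fb _ _ O.
      have /ler_normlP[H1 H2] := Hb (ux' t y).
      have uL := uxL _ _ O.
      have [_ bK] := coef _ _ O.
      have b1 : b y * ux' t y <= K * L.
        by apply: (le_trans (ler_norm _)); rewrite normrM; apply: ler_pM.
      have q : ux' t y ^+ 2 <= L ^+ 2.
        by rewrite -[leLHS]real_normK ?num_real// ler_pXn2r// nnegrE// /L; lra.
      by have := ler_wpM2l K0 q; rewrite /C; lra.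
    - move=> y ty; have /ler_normlP[_ h] := sp _ _ _ ty tx2.
      have : 0 <= K * `|y - x| by rewrite mulr_ge0//; lra.
      by rewrite /L; lra.
    - move=> t y ty tt2 yb.
      rewrite (bd _ _ ty (or_intror yb)).
      (* the boundary point at time t2 that (t, y) moves to *)
      pose y2 := if y == z t then z t2 else m%:R.
      have ty2 : Om_bar T z m (t2, y2).
        have [/= tT _] := tx2; split => //=; rewrite /y2.
        by case: ifP => _; rewrite lexx ?andbT ?(le_trans zx xm).
      have y2b : t2 = T \/ y2 = z t2 \/ y2 = m%:R.
        by right; rewrite /y2; case: ifP => _; [left|right].
      have := sp _ _ _ ty2 tx2; rewrite (bd _ _ ty2 y2b) => /ler_normlP[_ s1].
      have := Glip _ _ _ _ (Om_bar_Obar z0 ty) (Om_bar_Obar z0 ty2).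
      move=> /ler_normlP[_ g1].
      (* On the left edge monotonicity gives [z t <= z t2 <= x], so the displacement of the boundary
         is part of the distance from [y] to [x] and never has to be bounded by [t2 - t]. On the
         right edge [y2 = y]. *)
      have tri : `|y - y2| + `|y2 - x| = `|y - x|.
        rewrite /y2; case: ifPn => [/eqP ->|yz].
          have zz := zn _ _ tt2.
          rewrite !ler0_norm; clear - zz zx; lra.
        case: yb => [yz'|->]; first by rewrite yz' eqxx in yz.
        by rewrite subrr normr0 add0r.
      have -> : `|y - x| = `|y - y2| + `|y2 - x| by [].
      rewrite (distrC t t2) (ger0_norm (_ : 0 <= t2 - t)) in g1; last lra.
      have : 0 <= Ls * `|y - y2| by rewrite mulr_ge0// ltW.
      have : 0 <= K * `|y2 - x| by rewrite mulr_ge0//; lra.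
      by rewrite /L; lra.
  apply: (le_trans tm).
  have -> : (C + K + 1 + K * (L ^+ 2 / (2 * eta))) * (t2 - t1) =
      (C + K + 1) * eta ^+ 2 + K * L ^+ 2 / 2 * eta.
    by rewrite -etaE; field; rewrite gt_eqF.
  have e2 : eta ^+ 2 <= eta by rewrite expr2 ler_piMr// ltW.
  have CK : 0 <= C + K + 1 by lra.
  have := ler_wpM2l CK e2.
  have : 0 <= K * L ^+ 2 * eta by rewrite mulr_ge0// ltW.
  by rewrite -/eta; lra.
have h1 := one _ _ _ _ _ _ _ _ _ _ P.
have h2 := one _ _ _ _ _ _ _ _ _ _ (quasilinear_problemN P).
by rewrite /= in h2; rewrite -/eta; apply/ler_normlP; split; lra.
Qed.

Lemma quasilinear_holder (R : realType) (k0 K : R) : 0 < k0 -> 1 <= K ->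
  exists2 L, 0 < L &
  forall (T : R) (z : R -> R) (m : nat) (a b H : R -> R)
    (G Gt Gx Gxx F u ut ux uxx : R -> R -> R),
  quasilinear_problem k0 K T z m a b H G Gt Gx Gxx F u ut ux uxx ->
  forall t1 x1 t2 x2, Om_bar T z m (t1, x1) -> Om_bar T z m (t2, x2) ->
    `|t2 - t1| <= 1 ->
    `|u t1 x1 - u t2 x2| <= L * (Num.sqrt `|t2 - t1| + `|x2 - x1|).
Proof.
move=> k00 K1.
have [Ls Ls0 space] := quasilinear_space k00 K1.
have [Lt Lt0 time] := quasilinear_time k00 K1.
exists (Ls + Lt); first lra.
move=> T z m a b H G Gt Gx Gxx F u ut ux uxx P.
have sp := space _ _ _ _ _ _ _ _ _ _ _ _ _ _ _ P.
have ti := time _ _ _ _ _ _ _ _ _ _ _ _ _ _ _ P.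
suff le12 t1 x1 t2 x2 : Om_bar T z m (t1, x1) -> Om_bar T z m (t2, x2) ->
    `|t2 - t1| <= 1 -> t1 <= t2 ->
    `|u t1 x1 - u t2 x2| <= (Ls + Lt) * (Num.sqrt `|t2 - t1| + `|x2 - x1|).
  move=> t1 x1 t2 x2 tx1 tx2 t12.
  have [le|/ltW le] := leP t1 t2; first exact: le12.
  by rewrite (distrC t2) (distrC x2) (distrC (u _ _)); apply: le12 => //; rewrite distrC.
move=> tx1 tx2 t12 le.
(* The intermediate corner has the earlier time: [z t1 <= z t2 <= x2] keeps it in the domain,
   whereas [(t2, x1)] may lie to the left of the boundary curve. *)
have tx12 : Om_bar T z m (t1, x2).
  move: tx1 tx2 => [/= h1 _] [/= _ /andP[h2 h3]]; split => //=.
  by rewrite h3 andbT (le_trans _ h2)// (ql_z_nondecr P).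
have t0 : 0 <= t2 - t1 by rewrite subr_ge0.
rewrite (ger0_norm t0) in t12 *.
have h1 := sp _ _ _ tx1 tx12; have h2 := ti _ _ _ tx12 tx2 le t12.
have h3 := ler_distD (u t1 x2) (u t1 x1) (u t2 x2).
have : 0 <= Ls * Num.sqrt (t2 - t1) by rewrite mulr_ge0 ?sqrtr_ge0// ltW.
have : 0 <= Lt * `|x2 - x1| by rewrite mulr_ge0// ltW.
by rewrite (distrC x1) in h1; lra.
Qed.

(** * The penalised equation *)

(** [H] packs [psi] together with its constant threshold. The parameters from [eps] to [Cg] are
    those allowed in the constants; [delta] is not among them. *)
Record penalised_problem (R : realType) (T r eps k0 k1 N Lg Cg delta : R)
    (z : R -> R) (m : nat) (a b H : R -> R)
    (G Gt Gx Gxx h u ut ux uxx : R -> R -> R) : Prop := {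
  pen_z_cont : continuous z ;
  pen_z_ge0 : forall t, 0 <= z t ;
  pen_z_nondecr : forall s t, s <= t -> z s <= z t ;
  pen_u_cont : {within Om_bar T z m, continuous (fun q : R * R => u q.1 q.2)} ;
  pen_u_jets : jets (Om T z m) u ut ux uxx ;
  pen_G_jets : jets (Om T z m) G Gt Gx Gxx ;
  pen_G_bound : forall t x, Om_bar T z m (t, x) -> 0 <= G t x <= N ;
  pen_G_lip : forall t x s y, Obar T (t, x) -> Obar T (s, y) ->
    `|G t x - G s y| <= Lg * (`|x - y| + `|t - s|) ;
  pen_dG_bound : forall t x, Om T z m (t, x) ->
    [/\ `|Gt t x| <= Cg, `|Gx t x| <= Cg & `|Gxx t x| <= Cg] ;
  pen_h_bound : forall t x, Om T z m (t, x) -> 0 <= h t x <= N ;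
  pen_coef : forall t x, Om T z m (t, x) -> k0 <= a x <= k1 /\ `|b x| <= k1 ;
  pen_delta : 0 < delta ;
  pen_H0 : H 0 = 0 ;
  pen_H : forall q, 0 <= H q <= 1 + q ^+ 2 / eps ;
  pen_eq : forall t x, Om T z m (t, x) ->
    ut t x + a x * uxx t x + b x * ux t x - r * u t x =
    - h t x - delta^-1 * Num.max (G t x - u t x) 0 + H (ux t x) ;
  pen_bd : forall t x, Om_bar T z m (t, x) -> t = T \/ x = z t \/ x = m%:R ->
    u t x = G t x
}.

(** At a negative minimum [H 0 = 0] removes the gradient penalty, while [G >= 0 > u] makes the
    obstacle penalty strictly positive: the right side is negative and the left side is not. *)
Lemma penalised_ge0 (R : realType) (T r eps k0 k1 N Lg Cg delta : R)
    (z : R -> R) (m : nat) (a b H : R -> R)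
    (G Gt Gx Gxx h u ut ux uxx : R -> R -> R) :
  0 <= r -> 0 < k0 ->
  penalised_problem T r eps k0 k1 N Lg Cg delta z m a b H
    G Gt Gx Gxx h u ut ux uxx ->
  forall t x, Om_bar T z m (t, x) -> 0 <= u t x.
Proof.
move=> r0 k00 P.
have [cz z0 zn cu ju jG Gb Glip dG hb coef d0 H0 Hb pde bd] := P.
move=> t x tx; suff : -1 * u t x <= 0 by lra.
move: t x tx.
apply: (@comparison _ T 0 z m _ _ _ _ (fun _ _ => 0) (fun _ _ => 0) (fun _ _ => 0)
  cz z0 _ _ (jetsZ (-1) ju)).
- by move=> q; apply: cvgM; [exact: cvg_cst|exact: cu].
- by move=> q; exact: cvg_cst.
- by move=> s t x _ _ _; rewrite mul0r subr0.
- by move=> t x tx tb; rewrite (bd _ _ tx tb); have := Gb _ _ tx; lra.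
move=> t x O; rewrite /= oppr0 => u0 h1 h2 h3.
have E := pde _ _ O; have [/andP[ak0 _] _] := coef _ _ O.
have ux0 : ux t x = 0 by lra.
rewrite ux0 H0 mulr0 in E.
have /andP[G0 _] := Gb _ _ (Om_Om_bar O).
have /andP[h0 _] := hb _ _ O.
have pos : 0 < delta^-1 * Num.max (G t x - u t x) 0.
  by rewrite mulr_gt0 ?invr_gt0// lt_max; apply/orP; left; lra.
have : 0 <= a x * uxx t x by rewrite mulr_ge0//; lra.
have : 0 <= r * - u t x by rewrite mulr_ge0//; lra.
lra.
Qed.

(** The comparison function is [N + (N + 1) * (T - t)]: above [N] the obstacle is inactive, and the
    rate [N + 1] strictly beats the source [h <= N]. *)
Lemma penalised_le (R : realType) (T r eps k0 k1 N Lg Cg delta : R)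
    (z : R -> R) (m : nat) (a b H : R -> R)
    (G Gt Gx Gxx h u ut ux uxx : R -> R -> R) :
  0 <= r -> 0 < k0 -> 0 <= N ->
  penalised_problem T r eps k0 k1 N Lg Cg delta z m a b H
    G Gt Gx Gxx h u ut ux uxx ->
  forall t x, Om_bar T z m (t, x) -> u t x <= N + (N + 1) * T.
Proof.
move=> r0 k00 N0 P.
have [cz z0 zn cu ju jG Gb Glip dG hb coef d0 H0 Hb pde bd] := P.
move=> t x tx; apply: (@le_trans _ _ (N + (N + 1) * (T - t))); last first.
  by rewrite lerD2l ler_wpM2l//; [lra|move: tx => [/= /andP[]]; lra].
move: t x tx.
apply: (@comparison _ T (N + 1) z m u ut ux uxx _ (fun _ _ => 0) (fun _ _ => 0)
  cz z0 cu _ ju).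
- apply: continuous_subspaceT => q.
  apply: cvgD; first exact: cvg_cst.
  apply: cvgM; first exact: cvg_cst.
  by apply: cvgB; [exact: cvg_cst|exact: cvg_fst].
- by move=> s t x _ _ _; lra.
- move=> t x tx tb; rewrite (bd _ _ tx tb); have /andP[_ GN] := Gb _ _ tx.
  apply: (le_trans GN); rewrite lerDl mulr_ge0//; first lra.
  by move: tx => [/= /andP[]]; lra.
move=> t x O /= u0 h1 h2 h3.
have E := pde _ _ O; have [/andP[ak0 _] _] := coef _ _ O.
rewrite h2 H0 mulr0 in E.
have /andP[G0 GN] := Gb _ _ (Om_Om_bar O).
have /andP[h0 hN] := hb _ _ O.
have Tt : 0 <= (N + 1) * (T - t).
  by rewrite mulr_ge0//; [lra|move: (Om_Om_bar O) => [/= /andP[]]; lra].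
have mx : Num.max (G t x - u t x) 0 = 0 by apply/max_idPr; lra.
rewrite mx mulr0 in E.
have : 0 <= a x * - uxx t x by rewrite mulr_ge0//; lra.
have : 0 <= r * u t x by rewrite mulr_ge0//; lra.
lra.
Qed.

(* At a maximum of G - u the gradients agree, so the gradient penalty is at most
   1 + Cg ^+ 2 / eps there and the equation bounds the obstacle penalty. *)
Lemma obstacle_penalty_le (R : realType) (T r eps k0 k1 N Lg Cg delta : R)
    (z : R -> R) (m : nat) (a b H : R -> R)
    (G Gt Gx Gxx h u ut ux uxx : R -> R -> R) :
  0 <= T -> 0 <= r -> 0 < eps -> 0 < k0 -> 0 <= k1 -> 0 <= N -> 0 <= Cg ->
  penalised_problem T r eps k0 k1 N Lg Cg delta z m a b H
    G Gt Gx Gxx h u ut ux uxx ->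
  forall t x, Om_bar T z m (t, x) ->
  G t x - u t x <=
    delta * (Cg * (1 + 2 * k1) + r * (N + (N + 1) * T) + (1 + Cg ^+ 2 / eps)).
Proof.
move=> T0 r0 eps0 k00 k10 N0 Cg0 P.
have [cz z0 zn cu ju jG Gb Glip dG hb coef d0 H0 Hb pde bd] := P.
(* The three summands bound [Gt] with [a * Gxx] and [b * Gx], the discount term [r * u], and the
   gradient penalty at slope [Gx]. *)
pose C := Cg * (1 + 2 * k1) + r * (N + (N + 1) * T) + (1 + Cg ^+ 2 / eps).
have Cg2 : 0 <= Cg ^+ 2 / eps by rewrite divr_ge0 ?sqr_ge0// ltW.
have rM : 0 <= r * (N + (N + 1) * T).
  by rewrite mulr_ge0// addr_ge0// mulr_ge0//; lra.
have C0 : 0 <= C.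
  by rewrite !addr_ge0// mulr_ge0//; lra.
apply: (@comparison _ T 0 z m _ _ _ _ (fun _ _ => delta * C) (fun _ _ => 0)
  (fun _ _ => 0) cz z0 _ _ (jetsB jG ju)).
- have cG : {within Om_bar T z m, continuous (fun q : R * R => G q.1 q.2)}.
    apply: (@lip_within_continuous _ _ `|Lg|) => // t x s y tx sy.
    apply: (le_trans (Glip _ _ _ _ (Om_bar_Obar z0 tx) (Om_bar_Obar z0 sy))).
    by rewrite ler_wpM2r ?ler_norm// addr_ge0.
  by move=> q; apply: cvgB; [exact: cG|exact: cu].
- by move=> q; exact: cvg_cst.
- by move=> s t x _ _ _; rewrite mul0r subr0.
- by move=> t x tx tb; rewrite (bd _ _ tx tb) subrr mulr_ge0// ltW.
move=> t x O; rewrite /= oppr0 => Gu h1 h2 h3.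
have E := pde _ _ O; have [/andP[ak0 ak1] bk] := coef _ _ O.
have [d1 d2 d3] := dG _ _ O.
have exG : ux t x = Gx t x by lra.
rewrite exG in E.
have uM := penalised_le r0 k00 N0 P (Om_Om_bar O).
have /andP[h0 hN] := hb _ _ O.
have dC : 0 <= delta * C by rewrite mulr_ge0// ltW.
have mx : Num.max (G t x - u t x) 0 = G t x - u t x by apply/max_idPl; lra.
rewrite mx in E.
have pen : C < delta^-1 * (G t x - u t x) by rewrite ltr_pdivlMl.
have /andP[_ Hq] := Hb (Gx t x).
have Gx2 : Gx t x ^+ 2 / eps <= Cg ^+ 2 / eps.
  rewrite ler_pM2r ?invr_gt0//.
  by rewrite -[leLHS]real_normK ?num_real// ler_pXn2r// nnegrE.
have ru : r * u t x <= r * (N + (N + 1) * T) by rewrite ler_wpM2l.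
have e1 : a x * Gxx t x <= a x * uxx t x by rewrite ler_wpM2l//; lra.
have e2 : - (k1 * Cg) <= a x * Gxx t x.
  rewrite lerNl; apply: (le_trans (ler_norm _)); rewrite normrN normrM.
  by apply: ler_pM => //; rewrite ger0_norm//; lra.
have e3 : - (k1 * Cg) <= b x * Gx t x.
  rewrite lerNl; apply: (le_trans (ler_norm _)); rewrite normrN normrM.
  by apply: ler_pM.
have /ler_normlP[e4 _] := d1.
rewrite /C in pen; lra.
Qed.

(** Since [u] and the whole term [delta^-1 * Num.max (G - u) 0] have bounds free of [delta], both
    can be moved into the source [F] of a quasilinear problem. *)
Lemma penalised_holder (R : realType) (T r eps k0 k1 N Lg Cg : R) :
  0 <= T -> 0 <= r -> 0 < eps -> 0 < k0 -> 0 <= k1 -> 0 <= N -> 0 <= Lg -> 0 <= Cg ->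
  exists2 L, 0 < L &
  forall (delta : R) (z : R -> R) (m : nat) (a b H : R -> R)
    (G Gt Gx Gxx h u ut ux uxx : R -> R -> R),
  penalised_problem T r eps k0 k1 N Lg Cg delta z m a b H
    G Gt Gx Gxx h u ut ux uxx ->
  forall t1 x1 t2 x2, Om_bar T z m (t1, x1) -> Om_bar T z m (t2, x2) ->
    `|t2 - t1| <= 1 ->
    `|u t1 x1 - u t2 x2| <= L * (Num.sqrt `|t2 - t1| + `|x2 - x1|).
Proof.
move=> T0 r0 eps0 k00 k10 N0 Lg0 Cg0.
pose M := N + (N + 1) * T.
pose C := Cg * (1 + 2 * k1) + r * M + (1 + Cg ^+ 2 / eps).
have M0 : 0 <= M by rewrite addr_ge0// mulr_ge0//; lra.
have rM : 0 <= r * M by rewrite mulr_ge0.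
have ie : 0 < eps^-1 by rewrite invr_gt0.
have C0 : 0 <= C.
  by rewrite !addr_ge0// ?mulr_ge0// ?sqr_ge0 ?ltW//; lra.
pose K := 1 + Lg + Cg + k1 + N + M + (r * M + N + C) + eps^-1.
have K1 : 1 <= K by rewrite /K; lra.
have [L L0 HL] := quasilinear_holder k00 K1.
exists L => // delta z m a b H G Gt Gx Gxx h u ut ux uxx P.
have u0 := penalised_ge0 r0 k00 P.
have uM := penalised_le r0 k00 N0 P.
have pen := obstacle_penalty_le T0 r0 eps0 k00 k10 N0 Cg0 P.
have [cz z0 zn cu ju jG Gb Glip dG hb coef d0 H0 Hb pde bd] := P.
apply: (HL T z m a b H G Gt Gx Gxx
  (fun t x => r * u t x - h t x - delta^-1 * Num.max (G t x - u t x) 0) u ut ux uxx).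
split => //.
- move=> t x tx; rewrite ger0_norm ?u0//; have := uM _ _ tx.
  by rewrite /K -/M; lra.
- by move=> t x tx; have /andP[g0 gN] := Gb _ _ tx; rewrite ger0_norm// /K; lra.
- move=> t x s y tx sy; apply: (le_trans (Glip _ _ _ _ tx sy)).
  by rewrite ler_wpM2r ?addr_ge0// /K; lra.
- by move=> t x O; have [h1 h2 h3] := dG _ _ O; split; rewrite /K; lra.
- move=> t x O; have [/andP[h1 h2] h3] := coef _ _ O.
  by split; [rewrite h1|]; rewrite /K; lra.
- move=> t x O; have tx := Om_Om_bar O.
  have p0 : 0 <= delta^-1 * Num.max (G t x - u t x) 0.
    by rewrite mulr_ge0 ?invr_ge0 ?(ltW d0)// le_max lexx orbT.
  have pC : delta^-1 * Num.max (G t x - u t x) 0 <= C.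
    by rewrite ler_pdivrMl// ge_max pen//= mulr_ge0// ltW.
  have ru : r * u t x <= r * M by rewrite ler_wpM2l// uM.
  have ru0 : 0 <= r * u t x by rewrite mulr_ge0// u0.
  have /andP[h0 hN] := hb _ _ O.
  by apply/ler_normlP; split; rewrite /K; lra.
- move=> q; have /andP[q0 q1] := Hb q; rewrite ger0_norm//.
  apply: (le_trans q1); rewrite mulrDr mulr1 lerD//.
  by rewrite mulrC ler_wpM2r ?sqr_ge0// /K; lra.
- by move=> t x O; have := pde _ _ O; lra.
Qed.

(** * The localised data *)

Lemma has_deriv_in_near (R : realType) (D : set R) (f : R -> R) (x l e : R) :
  has_deriv_in D f x l -> 0 < e ->
  exists2 d, 0 < d & forall y, D y -> `|y - x| < d -> `|f y - f x| < e.
Proof.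
move=> Hf e0; have [d d0 Hd] := Hf _ ltr01.
have l0 : 0 < `|l| + 1 by have := normr_ge0 l; lra.
exists (Num.min d (e / (`|l| + 1))); first by rewrite lt_min d0 divr_gt0.
move=> y Dy; rewrite lt_min => /andP[yd]; rewrite ltr_pdivlMr// => ye.
have := Hd _ Dy yd; rewrite mul1r => h.
have := ler_normD (f y - f x - l * (y - x)) (l * (y - x)).
by rewrite subrK normrM; lra.
Qed.

(** A point of [Om] has a space neighbourhood and a short later time interval inside [D], so the
    relative derivatives are two-sided in [x] and at least right derivatives in [t]. *)
Lemma has_derivatives_jets (R : realType) (D : set (R * R)) (T : R) (z : R -> R)
    (m : nat) (f : R -> R -> R) :
  continuous z -> Om T z m `<=` D -> has_derivatives D 1 2 f ->
  jets (Om T z m) f (dt D f) (dx D f) (dxx D f).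
Proof.
move=> cz sub [ft fx]; split => t x O.
- have [d d0 Hd] := Om_time_nbhs cz O.
  apply: (has_deriv_in_right d0 (D := [set s | D (s, x)])).
    by move=> s /Hd/sub.
  exact: derivable_in_has_deriv (ft 0%N _ _ isT (sub _ O)).
- have [d d0 Hd] := Om_space_nbhs O.
  apply: (has_deriv_in_is_derive d0 (D := [set y | D (t, y)])).
    by move=> s /Hd/sub.
  exact: derivable_in_has_deriv (fx 0%N _ _ isT (sub _ O)).
- have [d d0 Hd] := Om_space_nbhs O.
  apply: (has_deriv_in_is_derive d0 (D := [set y | D (t, y)])).
    by move=> s /Hd/sub.
  exact: derivable_in_has_deriv (fx 1%N _ _ isT (sub _ O)).
Qed.

Lemma pholder_within_continuous (R : realType) (gamma : R) (D : set (R * R))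
    (f : R -> R -> R) :
  0 < gamma -> pholder gamma D f ->
  {within D, continuous (fun q : R * R => f q.1 q.2)}.
Proof.
move=> g0 [C HC]; apply: uniform_within_continuous => e e0.
have C1 : 0 < `|C| + 1 by have := normr_ge0 C; lra.
pose eta := (e / (`|C| + 1)) `^ gamma^-1.
have eta0 : 0 < eta by rewrite powR_gt0// divr_gt0.
have eta20 : 0 < eta ^+ 2 by rewrite exprn_gt0.
(* The bound 1 makes the squared space increment at most the increment itself, so both terms under
   the root of [pdist] stay below [eta ^+ 2 / 2]. *)
exists (Num.min 1 (eta ^+ 2 / 2)); first by rewrite lt_min ltr01/= divr_gt0.
move=> p q Dp Dq; rewrite !lt_min => /andP[h1 h2] /andP[h3 h4].
have sq : `|p.2 - q.2| ^+ 2 <= `|p.2 - q.2| by rewrite expr2 ler_piMr// ltW.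
have lt : pdist p q < eta.
  rewrite /pdist -(gtr0_norm eta0) -(sqrtr_sqr eta) ltr_sqrt//; lra.
apply: (le_lt_trans (HC _ _ Dp Dq)).
have dp0 : 0 <= pdist p q by exact: sqrtr_ge0.
have : pdist p q `^ gamma < e / (`|C| + 1).
  have -> : e / (`|C| + 1) = eta `^ gamma.
    by rewrite -powRrM mulVf ?gt_eqF// powRr1// ltW// divr_gt0.
  by rewrite gt0_ltr_powR// nnegrE ltW.
rewrite ltr_pdivlMr// => h.
have pw0 := powR_ge0 (pdist p q) gamma.
have := ler_wpM2r pw0 (ler_norm C); lra.
Qed.

(** [zeta m] is prescribed on [[0, T]] only, while the comparison principle wants a curve that is
    continuous and nonnegative on the whole line; freezing it outside the interval also keeps it
    nondecreasing. *)
Definition clamp (R : realType) (T t : R) : R := Num.max 0 (Num.min t T).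

Lemma clamp_itv (R : realType) (T t : R) : 0 <= T -> 0 <= clamp T t <= T.
Proof. by move=> T0; rewrite /clamp le_max lexx/= ge_max T0 ge_min lexx orbT. Qed.

Lemma clamp_id (R : realType) (T t : R) : 0 <= t <= T -> clamp T t = t.
Proof. by move=> /andP[t0 tT]; rewrite /clamp (min_idPl tT); apply/max_idPr. Qed.

Lemma clamp_nondecr (R : realType) (T s t : R) : s <= t -> clamp T s <= clamp T t.
Proof.
move=> st; rewrite /clamp ge_max !le_max lexx/= ge_min; apply/orP; right.
by rewrite le_min ge_min st ge_min lexx orbT.
Qed.

Lemma clamp_lip (R : realType) (T s t : R) : `|clamp T s - clamp T t| <= `|s - t|.
Proof.
wlog st : s t / s <= t.
  move=> H; have [/H//|/ltW/H] := leP s t.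
  by rewrite distrC [X in _ <= X]distrC.
rewrite distrC [X in _ <= X]distrC ger0_norm ?subr_ge0 ?clamp_nondecr//.
rewrite ger0_norm ?subr_ge0// /clamp.
by have [] := leP s T; have [] := leP t T; have [] := leP 0 s; have [] := leP 0 t;
  have [] := leP 0 T; lra.
Qed.

Lemma clamp_continuous (R : realType) (T : R) (f : R -> R) : 0 <= T ->
  (forall t, 0 <= t <= T -> derivable_in `[0, T] f t) ->
  continuous (fun t => f (clamp T t)).
Proof.
move=> T0 df t; apply/cvgrPdist_lt => e e0.
have [d d0 Hd] :=
  has_deriv_in_near (derivable_in_has_deriv (df _ (clamp_itv t T0))) e0.
apply/nbhs_ballP; exists d => //= s ts; rewrite distrC; apply: Hd.
  by rewrite /= in_itv/= clamp_itv.
by apply: (le_lt_trans (clamp_lip _ _ _)); rewrite distrC.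
Qed.

Lemma deriv_in_lip (R : realType) (f : R -> R) (L : R) :
  (forall x, 0 <= x -> derivable_in `[0, +oo[ f x) ->
  (forall x, 0 <= x -> `|deriv_in `[0, +oo[ f x| <= L) ->
  forall x y, 0 <= x -> 0 <= y -> `|f x - f y| <= L * `|x - y|.
Proof.
move=> df fL.
suff H x y : 0 <= x -> x < y -> `|f y - f x| <= L * `|y - x|.
  move=> x y x0 y0; have [xy|yx|->] := ltgtP x y; last 1 first.
  - by rewrite !subrr normr0 mulr0.
  - by rewrite distrC (distrC x); exact: H.
  - exact: H.
move=> x0 xy.
have [||c] := @MVT _ f (deriv_in `[0, +oo[ f) x y xy.
- move=> w; rewrite in_itv/= => /andP[xw wy].
  have w0 : 0 < w by exact: le_lt_trans xw.
  apply: (has_deriv_in_is_derive w0 _ (derivable_in_has_deriv (df _ (ltW w0)))).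
  by move=> v /ltr_normlP[]; rewrite /= in_itv/= andbT; lra.
- apply/subspace_continuousP => w; rewrite /= in_itv/= => /andP[xw wy].
  apply/cvgrPdist_lt => e e0.
  have [d d0 Hd] := has_deriv_in_near
    (derivable_in_has_deriv (df _ (le_trans x0 xw))) e0.
  rewrite near_withinE; apply/nbhs_ballP; exists d => //= v wv.
  rewrite in_itv/= => /andP[xv _]; rewrite distrC; apply: Hd; last by rewrite distrC.
  by rewrite /= in_itv/= andbT (le_trans x0).
rewrite in_itv/= => /andP[xc _] ->.
by rewrite normrM ler_wpM2r// fL// (le_trans x0)// ltW.
Qed.

(** Up to [2 * eps] monotonicity bounds [psi] by its value 1 there; afterwards the linear formula
    gives at most [q ^+ 2 / eps]. *)
Lemma penalty_le (R : realType) (eps : R) (psi : R -> R) : 0 < eps ->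
  penalty eps psi -> forall A q, 0 <= A -> psi (`|q| ^+ 2 - A) <= 1 + q ^+ 2 / eps.
Proof.
move=> e0 [d1 d2 c2 p0 _ pn pp mono lin] A q A0.
rewrite (real_normK (num_real q)).
have q0 : 0 <= q ^+ 2 / eps by rewrite divr_ge0 ?sqr_ge0// ltW.
have [h|h] := leP (2 * eps) (q ^+ 2 - A).
  rewrite lin// ler_pdivrMr// mulrDl mul1r divfK ?gt_eqF//; lra.
apply: (@le_trans _ _ 1); last by rewrite lerDl.
have <- : psi (2 * eps) = 1 by rewrite lin//; field; rewrite gt_eqF.
have [||c] := @MVT _ psi (derive1 psi) _ _ h.
- by move=> y _; rewrite derive1E; apply: DeriveDef.
- apply: derivable_within_continuous => y _; exact: d1.
move=> _ E; rewrite -subr_ge0 E mulr_ge0//; lra.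
Qed.

Lemma jetsM (R : realType) (D : set (R * R)) (f f1 f2 : R -> R)
    (g gt gx gxx : R -> R -> R) :
  (forall t x, D (t, x) -> is_derive x (1 : R) f (f1 x)) ->
  (forall t x, D (t, x) -> is_derive x (1 : R) f1 (f2 x)) ->
  jets D g gt gx gxx ->
  jets D (fun t x => f x * g t x) (fun t x => f x * gt t x)
    (fun t x => f x * gx t x + g t x * f1 x)
    (fun t x => (f x * gxx t x + gx t x * f1 x) + (g t x * f2 x + f1 x * gx t x)).
Proof.
move=> Hf1 Hf2 [g1 g2 g3]; split => t x tx.
- exact: right_derivZ (g1 _ _ tx).
- exact: is_deriveM (Hf1 _ _ tx) (g2 _ _ tx).
- apply: is_deriveD.
    exact: is_deriveM (Hf1 _ _ tx) (g3 _ _ tx).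
  exact: is_deriveM (g2 _ _ tx) (Hf2 _ _ tx).
Qed.

(** * Cut-off functions and localised payoffs *)

Section cutoff.
Context (R : realType) (C0 : R) (xi : nat -> R -> R) (Hxi : space_cutoff C0 xi).

Let xi1 m := deriv_in `[0, +oo[ (xi m).

Lemma space_cutoff_ge0 : 0 <= C0.
Proof.
have := xi_d1 Hxi 0 (lexx 0).
rewrite (xi_1 Hxi (lexx 0) (ler0n _ _)) mulr1; apply: le_trans; exact: sqr_ge0.
Qed.

(** The squared derivative is at most [C0 * xi m x <= C0 <= (1 + C0) ^+ 2]; the bound [1 + C0]
    avoids a square root and is free of [m]. *)
Lemma space_cutoff_d1 (m : nat) (x : R) : 0 <= x -> `|xi1 m x| <= 1 + C0.
Proof.
move=> x0; have C00 := space_cutoff_ge0.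
have /andP[xi0 xi1'] := xi_bounds Hxi m x0.
have h : `|xi1 m x| ^+ 2 <= (1 + C0) ^+ 2.
  apply: (le_trans (xi_d1 Hxi m x0)); apply: (@le_trans _ _ C0).
    by rewrite ler_piMr.
  by have : 0 <= C0 ^+ 2 by [exact: sqr_ge0]; lra.
by rewrite -(ler_pXn2r (isT : (0 < 2)%N))// nnegrE// addr_ge0.
Qed.

Lemma space_cutoff_lip (m : nat) (x y : R) : 0 <= x -> 0 <= y ->
  `|xi m x - xi m y| <= (1 + C0) * `|x - y|.
Proof.
apply: deriv_in_lip => {}x x0; last exact: space_cutoff_d1.
by apply: (xi_smooth Hxi (m := m) (n := 0%N)); rewrite /= in_itv/= x0.
Qed.

Lemma space_cutoff_is_derive (m n : nat) (x : R) : 0 < x ->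
  is_derive x (1 : R) (iter n (deriv_in `[0, +oo[) (xi m))
    (iter n.+1 (deriv_in `[0, +oo[) (xi m) x).
Proof.
move=> x0; have xD : `[0, +oo[%classic x by rewrite /= in_itv/= ltW.
apply: (has_deriv_in_is_derive x0 _
  (derivable_in_has_deriv (xi_smooth Hxi (m := m) (n := n) xD))).
by move=> v /ltr_normlP[]; rewrite /= in_itv/= andbT; lra.
Qed.

Lemma space_cutoff_flat (m : nat) (x : R) : 0 < x -> x < m%:R -> xi1 m x = 0.
Proof.
move=> x0 xm; apply/eqP; rewrite -normr_le0.
have d0 : 0 < Num.min x (m%:R - x) by rewrite lt_min x0 subr_gt0.
apply: (is_derive_lip d0 (space_cutoff_is_derive m 0 x0)) => y.
rewrite lt_min !ltr_norml => /andP[h1 h2].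
rewrite /= !(xi_1 Hxi); [|lra..].
by rewrite subrr normr0 mul0r.
Qed.

Lemma localise_bound (m : nat) (f : R -> R -> R) (N t x : R) : 0 <= x -> 0 <= f t x <= N ->
  0 <= localise xi m f t x <= N.
Proof.
move=> x0 /andP[f0 fN]; have /andP[h0 h1] := xi_bounds Hxi m.-1 x0.
by rewrite /localise mulr_ge0//= (le_trans _ fN)// ler_piMl.
Qed.

Lemma localise_lip (m : nat) (f : R -> R -> R) (N L T t x s y : R) :
  (forall t x, Obar T (t, x) -> 0 <= f t x <= N) ->
  (forall t x s y, Obar T (t, x) -> Obar T (s, y) ->
    `|f t x - f s y| <= L * (`|x - y| + `|t - s|)) ->
  Obar T (t, x) -> Obar T (s, y) ->
  `|localise xi m f t x - localise xi m f s y| <=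
    (`|L| + (1 + C0) * N) * (`|x - y| + `|t - s|).
Proof.
move=> fN fL tx sy; have [_ /= x0] := tx; have [_ /= y0] := sy.
have -> : localise xi m f t x - localise xi m f s y =
  xi m.-1 x * (f t x - f s y) + (xi m.-1 x - xi m.-1 y) * f s y.
  by rewrite /localise; ring.
have C00 := space_cutoff_ge0.
have /andP[h0 h1] := xi_bounds Hxi m.-1 x0.
have /andP[f0 fsN] := fN _ _ sy.
apply: (le_trans (ler_normD _ _)); rewrite !normrM mulrDl lerD//.
  rewrite (ger0_norm h0); apply: (@le_trans _ _ `|f t x - f s y|).
    by rewrite ler_piMl.
  apply: (le_trans (fL _ _ _ _ tx sy)).
  by rewrite ler_wpM2r ?ler_norm// addr_ge0.
rewrite (ger0_norm f0) [(1 + C0) * N * _]mulrAC.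
apply: ler_pM => //.
apply: (le_trans (space_cutoff_lip _ x0 y0)).
by rewrite ler_wpM2l ?lerDl//; lra.
Qed.

(** The index matters: the threshold is built with [xi m], which is flat up to [m], while [localise]
    uses [xi m.-1], which may vary on [[m - 1, m]]. *)
Lemma alpha_sq_flat (T : R) (N : nat) (alphaN : R) (gN : R -> R -> R) (m : nat)
    (t x : R) : 0 < x -> x < m%:R ->
  alpha_sq T N alphaN gN xi m t x = alphaN ^+ 2.
Proof.
move=> x0 xm; rewrite /alpha_sq -/(xi1 m) space_cutoff_flat//.
by rewrite normr0 expr0n/= !mulr0 mul0r !addr0.
Qed.

End cutoff.

(** * Assembly of the estimate *)

Lemma powR_le_unit (R : realType) (y q s : R) : 0 <= y <= 1 -> 0 < q -> q <= s ->
  y `^ s <= y `^ q.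
Proof.
move=> /andP[y0 y1] q0 qs; have [->|yn0] := eqVneq y 0.
  by rewrite !powR0 ?gt_eqF// (lt_le_trans q0).
by apply: ger_powR => //; rewrite y1 andbT lt_neqAle eq_sym yn0.
Qed.

Lemma localise_penalised (R : realType)
    (T r gamma theta delta kappa eps C0 B L alphaN : R) (N m : nat)
    (mu sigma : R -> R) (gN hN : R -> R -> R) (zeta : nat -> R -> R)
    (xi : nat -> R -> R) (psi : R -> R) (u : R -> R -> R) :
  0 < T -> 0 < gamma -> 0 < kappa -> 0 < eps -> 0 < delta -> (0 < m)%N ->
  m%:R^-1 < T ->
  (forall x, 0 <= x -> `|mu x| <= kappa^-1 /\ kappa <= sigma x <= kappa^-1) ->
  has_derivatives (Obar T) 1 2 gN ->
  (forall t x, Obar T (t, x) ->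
    [/\ `|gN t x| <= B, `|dt (Obar T) gN t x| <= B, `|dx (Obar T) gN t x| <= B &
        `|dxx (Obar T) gN t x| <= B]) ->
  (forall t x, Obar T (t, x) -> 0 <= gN t x <= N%:R) ->
  (forall t x s y, Obar T (t, x) -> Obar T (s, y) ->
    `|gN t x - gN s y| <= L * (`|x - y| + `|t - s|)) ->
  (forall t x, Obar T (t, x) -> 0 <= hN t x <= N%:R) ->
  time_cutoff T theta zeta -> space_cutoff C0 xi -> penalty eps psi ->
  penalised_solution T r gamma theta delta mu sigma (localise xi m gN)
    (localise xi m hN) (alpha_sq T N alphaN gN xi m) (zeta m) m psi u ->
  exists G1 G2 G3 u1 u2 u3 : R -> R -> R,
  let z := fun t => zeta m (clamp T t) in
  penalised_problem T r eps (kappa ^+ 2 / 2) (kappa^-1 + kappa^-1 ^+ 2) N%:R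
    (`|L| + (1 + C0) * N%:R) (4 * (1 + C0) * B) delta z m
    (fun x => sigma x ^+ 2 / 2) mu (fun q => psi (`|q| ^+ 2 - alphaN ^+ 2))
    (localise xi m gN) G1 G2 G3 (localise xi m hN) u u1 u2 u3.
Proof.
move=> T0 g0 k0 e0 d0 m0 mT coef gder gB gb glip hb Hzeta Hxi Hpsi.
move=> [[uder [uhol _] _] pde bd].
pose z t := zeta m (clamp T t).
have zE t : 0 <= t <= T -> z t = zeta m t by move=> tT; rewrite /z clamp_id.
have cz : continuous z.
  apply: clamp_continuous (ltW T0) _ => t tT.
  by apply: (zeta_smooth Hzeta m0 (n := 0%N)); rewrite /= in_itv.
(* The condition [m^-1 < T] puts time 0 in the range where [zeta m] vanishes; monotonicity does the
   rest. *)
have z0 t : 0 <= z t.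
  have /andP[c0 cT] := clamp_itv t (ltW T0).
  rewrite -(zeta_0 Hzeta m0 (lexx 0)); last lra.
  exact: (zeta_nondecr Hzeta m0).
have zn s t : s <= t -> z s <= z t.
  move=> st; have /andP[c0 _] := clamp_itv s (ltW T0).
  have /andP[_ cT] := clamp_itv t (ltW T0).
  by apply: (zeta_nondecr Hzeta m0) => //; exact: clamp_nondecr.
have OmE : Om T (zeta m) m = Om T z m.
  have zE' t : 0 <= t < T -> z t = zeta m t.
    by move=> /andP[t0 tT]; rewrite zE// t0 ltW.
  by apply/seteqP; split => -[t x] [[/= tT x0] h]; (split; first by split);
    move: h => /=; rewrite zE'.
have ObE : Om_bar T (zeta m) m = Om_bar T z m.
  by apply/seteqP; split => -[t x] [/= tT h]; split => //=; rewrite zE in h *.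
rewrite ObE OmE in uder uhol pde.
pose xi1 := deriv_in `[0, +oo[ (xi m.-1).
pose xi2 := deriv_in `[0, +oo[ xi1.
pose D := Om_bar T z m.
(* The product rule for [xi m.-1 * gN], in the shape delivered by [jetsM]. The second space
   derivative is at most [B + 2 * B * (1 + C0) + B * C0], hence the constant [4 * (1 + C0) * B]. *)
exists (fun t x => xi m.-1 x * dt (Obar T) gN t x),
  (fun t x => xi m.-1 x * dx (Obar T) gN t x + gN t x * xi1 x),
  (fun t x => (xi m.-1 x * dxx (Obar T) gN t x + dx (Obar T) gN t x * xi1 x) +
    (gN t x * xi2 x + xi1 x * dx (Obar T) gN t x)),
  (dt D u), (dx D u), (dxx D u).
have Obs : Om_bar T z m `<=` Obar T := Om_bar_Obar z0.
have Oms : Om T z m `<=` Obar T by move=> p /Om_Om_bar /Obs.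
have C00 := space_cutoff_ge0 Hxi.
have ik : 0 < kappa^-1 by rewrite invr_gt0.
have ik2 : 0 < kappa^-1 ^+ 2 by rewrite exprn_gt0.
split => //.
- exact: pholder_within_continuous g0 (uhol 0%N isT).
- exact: has_derivatives_jets cz (@Om_Om_bar _ _ _ _) uder.
- apply: (jetsM _ _ (has_derivatives_jets cz Oms gder)).
    by move=> t x [[_ /= x0] _]; exact: (space_cutoff_is_derive Hxi m.-1 0 x0).
  by move=> t x [[_ /= x0] _]; exact: (space_cutoff_is_derive Hxi m.-1 1 x0).
- by move=> t x /Obs tx; apply: (localise_bound Hxi); [case: tx|exact: gb].
- by move=> t x s y tx sy; exact: (localise_lip Hxi m gb glip tx sy).
- move=> t x O; have tx := Oms _ O; have [B0 B1 B2 B3] := gB _ _ tx.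
  have x0 : 0 <= x by case: tx.
  have B0' : 0 <= B := le_trans (normr_ge0 _) B0.
  have /andP[h0 h1] := xi_bounds Hxi m.-1 x0.
  have hx1 := space_cutoff_d1 Hxi m.-1 x0.
  have hx2 := xi_d2 Hxi m.-1 x0.
  have xiB v : `|v| <= B -> `|xi m.-1 x * v| <= B.
    move=> vB; rewrite normrM (ger0_norm h0); apply: le_trans vB.
    by rewrite ler_piMl.
  have x1B v : `|v| <= B -> `|v * xi1 x| <= B * (1 + C0).
    by move=> vB; rewrite normrM; apply: ler_pM.
  have x2B : `|gN t x * xi2 x| <= B * C0 by rewrite normrM; apply: ler_pM.
  have BC : 0 <= B * C0 by rewrite mulr_ge0.
  split.
  + by apply: (le_trans (xiB _ B1)); clear - B0' BC; lra.
  + apply: (le_trans (ler_normD _ _)).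
    have h2 := xiB _ B2; have h3 := x1B _ B0; clear - h2 h3 B0' BC; lra.
  + apply: (le_trans (ler_normD _ _)).
    have n1 :=
      ler_normD (xi m.-1 x * dxx (Obar T) gN t x) (dx (Obar T) gN t x * xi1 x).
    have n2 := ler_normD (gN t x * xi2 x) (dx (Obar T) gN t x * xi1 x).
    rewrite [xi1 x * _]mulrC.
    have h2 := xiB _ B3; have h3 := x1B _ B2.
    clear - n1 n2 h2 h3 x2B B0' BC; lra.
- by move=> t x /Oms tx; apply: (localise_bound Hxi); [case: tx|exact: hb].
- move=> t x /Oms[_ /= x0]; have [m1 /andP[s1 s2]] := coef _ x0.
  have s0 : 0 <= sigma x by lra.
  have q1 : kappa ^+ 2 <= sigma x ^+ 2.
    by rewrite ler_pXn2r// nnegrE ltW.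
  have q2 : sigma x ^+ 2 <= kappa^-1 ^+ 2.
    by rewrite ler_pXn2r// nnegrE ltW.
  by split; [apply/andP; split|]; lra.
- by rewrite normr0 expr0n/= sub0r (psi_npos Hpsi)// oppr_le0 sqr_ge0.
- by move=> q; rewrite (psi_ge0 Hpsi) (penalty_le e0 Hpsi)// sqr_ge0.
- move=> t x O; have [[_ /= x0] /andP[_ xm]] := O.
  have := pde _ _ O; rewrite (alpha_sq_flat Hxi)// /gen => <-.
  by rewrite /D; ring.
move=> t x [/= /andP[t0 tT] /andP[zx xm]] tb; apply: bd.
have [tlt|tge] := ltP t T.
  case: tb => [tE|[xz|xE]]; first by rewrite tE ltxx in tlt.
  - by left; left; rewrite /= t0 tlt; split => //; rewrite xz -(zE t) ?t0.
  - by left; right; rewrite /= t0 tlt.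
(* The terminal segment starts at [theta], which is the value of [zeta m] at [T]. *)
have tE : t = T by apply/eqP; rewrite eq_le tT.
right; split => //=; rewrite xm andbT -(zeta_T Hzeta m0) -tE.
by rewrite -zE// t0.
Qed.

Theorem theorem4p2 (R : realType)
  (T r alphabar gamma K0 K1 K2 D1 Dgamma gammas C0 : R)
  (mu sigma : R -> R) (g h : R -> R -> R)
  (gN hN : nat -> R -> R -> R) (alphaN LN : nat -> R)
  (muk sigmak : R -> R -> R)
  (zeta : nat -> R -> nat -> R -> R) (xi : nat -> R -> R)
  (psi : R -> R -> R)
  (T_gt0 : 0 < T) (r_ge0 : 0 <= r) (alphabar_gt0 : 0 < alphabar)
  (gamma_01 : 0 < gamma < 1)
  (Hsde : sde_assumption mu sigma D1 Dgamma gammas)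
  (Hpay : payoff_assumption T r alphabar gamma K0 K1 K2 mu sigma g h)
  (Happ : approx_payoff T alphabar gamma g h gN hN alphaN LN)
  (Hcoef : approx_coef D1 Dgamma gammas mu sigma muk sigmak)
  (Hzeta : forall (N : nat) (kappa : R), (0 < N)%N -> 0 < kappa < 1 ->
     time_cutoff T (first_zero T (Theta T r (muk kappa) (sigmak kappa) (gN N) (hN N)))
       (zeta N kappa))
  (Hxi : space_cutoff C0 xi)
  (Hpsi : forall eps : R, 0 < eps < 1 -> penalty eps (psi eps)) :
  forall (p : R) (N : nat) (kappa eps : R),
    1 < p -> (0 < N)%N -> 0 < kappa < 1 -> 0 < eps < 1 ->
  let theta :=
    first_zero T (Theta T r (muk kappa) (sigmak kappa) (gN N) (hN N)) in
  0 < theta ->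
  exists2 c0 : R, 0 < c0 &
  forall (m : nat) (delta : R) (u : R -> R -> R),
    let gNm := localise xi m (gN N) in
    let hNm := localise xi m (hN N) in
    m%:R^-1 < T ->
    first_zero T (Theta T r (muk kappa) (sigmak kappa) gNm hNm) = theta ->
    theta < m%:R ->
    0 < delta < 1 ->
    penalised_solution T r gamma theta delta (muk kappa) (sigmak kappa) gNm hNm
      (alpha_sq T N (alphaN N) (gN N) xi m) (zeta N kappa m) m (psi eps) u ->
  forall t1 x1 t2 x2 : R,
    Om T (zeta N kappa m) m (t1, x1) -> Om T (zeta N kappa m) m (t2, x2) ->
    Num.max `|t2 - t1| `|x2 - x1| <= 1 ->
    `|u t1 x1 - u t2 x2|
      <= c0 * (`|t2 - t1| `^ (Num.min (gamma / 2) ((p - 1) / (8 * p)))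
               + `|x2 - x1| `^ ((p - 1) / (4 * p))).
Proof.
move=> p N kappa eps p1 N0 /andP[k0 k1] /andP[e0 e1] theta th0.
have k01 : 0 < kappa < 1 by rewrite k0.
have e01 : 0 < eps < 1 by rewrite e0.
have /andP[g0 g1] := gamma_01.
have [gder _ [gbt gbx]] := app_g_reg Happ N0.
have [B0 HB0] := gbx 0%N isT; have [B1 HB1] := gbt 1%N isT.
have [B2 HB2] := gbx 1%N isT; have [B3 HB3] := gbx 2%N isT.
pose B := `|B0| + `|B1| + `|B2| + `|B3|.
have B_ge0 : 0 <= B by rewrite !addr_ge0.
have gB t x : Obar T (t, x) ->
    [/\ `|gN N t x| <= B, `|dt (Obar T) (gN N) t x| <= B,
        `|dx (Obar T) (gN N) t x| <= B & `|dxx (Obar T) (gN N) t x| <= B].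
  move=> tx; move: (HB0 _ tx) (HB1 _ tx) (HB2 _ tx) (HB3 _ tx).
  have [n0 n1 n2 n3] : [/\ `|B0| <= B, `|B1| <= B, `|B2| <= B & `|B3| <= B].
    rewrite /B; move: (normr_ge0 B0) (normr_ge0 B1) (normr_ge0 B2) (normr_ge0 B3).
    by clear=> *; split; lra.
  move=> h0 h1 h2 h3; split.
  - exact: le_trans h0 (le_trans (ler_norm _) n0).
  - exact: le_trans h1 (le_trans (ler_norm _) n1).
  - exact: le_trans h2 (le_trans (ler_norm _) n2).
  - exact: le_trans h3 (le_trans (ler_norm _) n3).
have C00 := space_cutoff_ge0 Hxi.
have gb t x : Obar T (t, x) -> 0 <= gN N t x <= N%:R.
  move=> tx; have /andP[h1 _] := app_g_bounds Happ N0 tx.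
  have /andP[h2 _] := app_h_bounds Happ N0 tx.
  by have := app_sum Happ N0 tx; rewrite h1; lra.
have hb t x : Obar T (t, x) -> 0 <= hN N t x <= N%:R.
  move=> tx; have /andP[h1 _] := app_g_bounds Happ N0 tx.
  have /andP[h2 _] := app_h_bounds Happ N0 tx.
  by have := app_sum Happ N0 tx; rewrite h2; lra.
have glip t x s y : Obar T (t, x) -> Obar T (s, y) ->
    `|gN N t x - gN N s y| <= alphaN N * (`|x - y| + `|t - s|).
  by move=> tx sy; exact: (app_g_lip Happ N0 tx sy).
have coef x : 0 <= x ->
    `|muk kappa x| <= kappa^-1 /\ kappa <= sigmak kappa x <= kappa^-1.
  by move=> x0; split; [exact: coef_mu_bound Hcoef _ _ k01 x0|
    exact: coef_sigma_bound Hcoef _ _ k01 x0].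
have c1 : 0 < kappa ^+ 2 / 2 by rewrite divr_gt0// exprn_gt0.
have c2 : 0 <= kappa^-1 + kappa^-1 ^+ 2 by rewrite addr_ge0 ?sqr_ge0// invr_ge0 ltW.
have c3 : 0 <= `|alphaN N| + (1 + C0) * N%:R by rewrite addr_ge0// mulr_ge0//; lra.
have c4 : 0 <= 4 * (1 + C0) * B by rewrite !mulr_ge0//; lra.
(* The constant is fixed here, from data of the unlocalised problem and [C0], before [m], [delta]
   and [u] are introduced. *)
have [L L0 HL] := penalised_holder (ltW T_gt0) r_ge0 e0 c1 c2 (ler0n R N) c3 c4.
exists L => // m delta u gNm hNm mT _ thm /andP[d0 d1] sol t1 x1 t2 x2 O1 O2 le1.
have m0 : (0 < m)%N by rewrite -(ltr0n R); exact: lt_trans thm.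
have [G1 [G2 [G3 [u1 [u2 [u3 P]]]]]] := localise_penalised T_gt0 g0 k0 e0 d0 m0 mT
  coef gder gB gb glip hb (Hzeta _ _ N0 k01) Hxi (Hpsi _ e01) sol.
have ObE t x : Om T (zeta N kappa m) m (t, x) ->
    Om_bar T (fun t => zeta N kappa m (clamp T t)) m (t, x).
  move=> /Om_Om_bar[/= tT zx]; split => //=; by rewrite clamp_id.
move: le1; rewrite ge_max => /andP[t1' x1'].
apply: (le_trans (HL _ _ _ _ _ _ _ _ _ _ _ _ _ _ _ P _ _ _ _ (ObE _ _ O1) (ObE _ _ O2) t1')).
(* Increments are at most 1, and [gamma / 2 <= 1 / 2] and [(p - 1) / (4 * p) <= 1], so each power
   dominates its square-root or linear counterpart. *)
rewrite ler_pM2l//; apply: lerD.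
  rewrite -powR12_sqrt//; apply: powR_le_unit; first by rewrite normr_ge0.
    by rewrite lt_min; apply/andP; split; rewrite divr_gt0//; clear - g0 p1; lra.
  by rewrite ge_min; apply/orP; left; clear - g0 g1; lra.
rewrite -[leLHS]powRr1//; apply: powR_le_unit; first by rewrite normr_ge0.
  by rewrite divr_gt0//; clear - g0 p1; lra.
by rewrite ler_pdivrMr; clear - p1; lra.
Qed.
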